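(* Assume that for every $\varphi\in\mathcal D$ there exists $\widetilde A[\varphi]\in L^2(\mathbb P_Y)$ such that for all $\chi\in\mathcal D$ $$\lim_{n\to\infty}\alpha_n\mathbb E[(\varphi(Y_n)-\varphi(Y))(\chi(Y_n)-\chi(Y))]=-2\,\mathbb E_Y[\widetilde A[\varphi]\,\chi],$$ and let $(\mathcal E,\mathbb D)$ be the associated Dirichlet form, with square field operator $\Gamma$ (see context). If $(\mathcal E,\mathbb D)$ is local, then for every integer $p\ge1$, all real-valued $f_1,\dots,f_p\in\mathcal D$ and every $F\in\mathcal C^1(\mathbb R^p,\mathbb R)$, $$\lim_n\alpha_n\mathbb E\big[(F(f_1(Y_n),\dots,f_p(Y_n))-F(f_1(Y),\dots,f_p(Y)))^2\big]=\mathbb E_Y\Big[\sum_{i,j=1}^pF'_i(f_1,\dots,f_p)F'_j(f_1,\dots,f_p)\,\Gamma[f_i,f_j]\Big],$$ where $F'_i$ denotes the $i$-th partial derivative of $F$.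
   Context: $Y$ and $Y_n$ ($n\in\mathbb N$) are random variables defined on the same probability space $(\Omega,\mathcal A,\mathbb P)$ with values in the same measurable space $(E,\mathcal F)$. $\mathbb P_Y$ is the law of $Y$ and $\mathbb E_Y$ denotes expectation (of functions on $E$) with respect to $\mathbb P_Y$. $\mathcal D$ is an algebra of bounded measurable functions from $E$ into $\mathbb R$ or $\mathbb C$, containing the constants and dense in $L^2(E,\mathcal F,\mathbb P_Y)$ (in the complex case, stable under complex conjugation); $(\alpha_n)$ is a sequence of positive numbers. Under the hypothesis of the claim, the form $\widetilde{\mathcal E}[\varphi,\chi]=\lim_n\frac{\alpha_n}{2}\mathbb E[(\varphi(Y_n)-\varphi(Y))(\chi(Y_n)-\chi(Y))]$ on $\mathcal D$ is closable in $L^2(\mathbb P_Y)$; its smallest closed extension $(\mathcal E,\mathbb D)$ is a Dirichlet form which admits a square field operator $\Gamma$ (a symmetric bilinear map with values in $L^1(\mathbb P_Y)$, $\Gamma[f]=\Gamma[f,f]$), satisfying on $\mathcal D$: $\Gamma[\varphi]=\widetilde A[\varphi^2]-2\varphi\widetilde A[\varphi]$ and $\mathbb E_Y[\Gamma[\varphi]\chi]=\lim_n\alpha_n\mathbb E[(\varphi(Y_n)-\varphi(Y))^2(\chi(Y_n)+\chi(Y))/2]$. Local: for every real $f\in\mathbb D$ and all $G,H\in C^\infty_c(\mathbb R)$ with disjoint supports, $\mathcal E[G(f)-G(0),H(f)-H(0)]=0$; equivalently (given the hypothesis), $\lim_n\alpha_n\mathbb E[(\varphi(Y_n)-\varphi(Y))^4]=0$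 for all $\varphi\in\mathcal D$. *)

(* Defs.v *)
From HB Require Import structures.
From mathcomp Require Import all_boot all_order all_algebra.
From mathcomp Require Import complex.
From mathcomp Require Import all_classical all_reals all_analysis.

Set Implicit Arguments.
Unset Strict Implicit.
Unset Printing Implicit Defensive.
Import Order.TTheory GRing.Theory Num.Theory numFieldNormedType.Exports.

Local Open Scope classical_set_scope.
Local Open Scope ring_scope.
Local Open Scope complex_scope.

(* All scalar functions take values in R[i]; the scalar field is a set
   K of complex numbers, which is either the real line or everything, so that
   the real and the complex theories are treated at once. Convergence in R[i]
   is written through R[i]^o, which carries the topology of the modulus. *)
Definition real_or_complex (R : realType) (K : set R[i]) : Prop :=
  K = [set z | complex.Im z = 0] \/ K = setT.

Definition modc (R : realType) (z : R[i]) : R := complex.Re `|z|.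

Definition toC (R : realType) (T : Type) (f : T -> R) : T -> R[i] :=
  fun x => (f x)%:C.

Definition conjf (R : realType) (T : Type) (f : T -> R[i]) : T -> R[i] :=
  fun x => (f x)^*.

Definition cint d (T : measurableType d) (R : realType)
    (mu : {measure set T -> \bar R}) (f : T -> R[i]) : R[i] :=
  Complex (\int[mu]_x complex.Re (f x)) (\int[mu]_x complex.Im (f x)).

(* K-valued functions (not classes) in L^p(mu), p in [1, +oo]. *)
Definition LfunK d (T : measurableType d) (R : realType) (K : set R[i])
    (mu : {measure set T -> \bar R}) (p : \bar R) (f : T -> R[i]) : Prop :=
  [/\ forall x, K (f x),
      (fun x => complex.Re (f x)) \in Lfun mu p
    & (fun x => complex.Im (f x)) \in Lfun mu p].

Record bounded_algebra d (T : measurableType d) (R : realType) (K : set R[i])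
    (D : set (T -> R[i])) : Prop := BoundedAlgebra {
  alg_scalar : forall f, D f -> forall x, K (f x) ;
  alg_measurable : forall f, D f ->
    measurable_fun setT (fun x => complex.Re (f x)) /\
    measurable_fun setT (fun x => complex.Im (f x)) ;
  alg_bounded : forall f, D f -> exists M : R, forall x, modc (f x) <= M ;
  alg_cst : forall c, K c -> D (fun=> c) ;
  alg_add : forall f g, D f -> D g -> D (fun x => f x + g x) ;
  alg_mul : forall f g, D f -> D g -> D (fun x => f x * g x) ;
  alg_conj : forall f, D f -> D (conjf f) }.

Definition dense_L2 d (T : measurableType d) (R : realType) (K : set R[i])
    (mu : {measure set T -> \bar R}) (D : set (T -> R[i])) : Prop :=
  forall g, LfunK K mu 2%:E g -> forall eps : R, 0 < eps ->
  exists2 f, D f & \int[mu]_x (modc (g x - f x) ^+ 2) < eps.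

(* Bilinear (not sesquilinear) forms; the quadratic form attached to form is
   f |-> form f (conjf f), which is form f f for real-valued f. *)
Definition norm1sq d (T : measurableType d) (R : realType)
    (mu : {measure set T -> \bar R})
    (form : (T -> R[i]) -> (T -> R[i]) -> R[i]) (f : T -> R[i]) : R :=
  complex.Re (form f (conjf f)) + \int[mu]_x (modc (f x) ^+ 2).

(* The domain is a set of functions, saturated for equality mu-almost
   everywhere; form is meaningful on dom only. *)
Record closed_form d (T : measurableType d) (R : realType) (K : set R[i])
    (mu : {measure set T -> \bar R}) (dom : set (T -> R[i]))
    (form : (T -> R[i]) -> (T -> R[i]) -> R[i]) : Prop := ClosedForm {
  dom_L2 : forall f, dom f -> LfunK K mu 2%:E f ;
  dom_ae : forall f g, dom f -> LfunK K mu 2%:E g ->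
    {ae mu, forall x, f x = g x} -> dom g ;
  dom_0 : dom (fun=> 0) ;
  dom_lin : forall a f g, K a -> dom f -> dom g ->
    dom (fun x => a * f x + g x) ;
  dom_conj : forall f, dom f -> dom (conjf f) ;
  form_ae : forall f f' g, dom f -> dom f' -> dom g ->
    {ae mu, forall x, f x = f' x} -> form f g = form f' g ;
  form_scalar : forall f g, dom f -> dom g -> K (form f g) ;
  form_sym : forall f g, dom f -> dom g -> form f g = form g f ;
  form_lin : forall a f g h, K a -> dom f -> dom g -> dom h ->
    form (fun x => a * f x + g x) h = a * form f h + form g h ;
  form_conj : forall f g, dom f -> dom g ->
    form (conjf f) (conjf g) = (form f g)^* ;
  form_ge0 : forall f, dom f -> 0 <= form f (conjf f) ;
  form_complete : forall f_ : nat -> T -> R[i], (forall n, dom (f_ n)) ->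
    (forall eps : R, 0 < eps -> exists N : nat, forall m n : nat,
       (N <= m)%N -> (N <= n)%N ->
       norm1sq mu form (fun x => f_ m x - f_ n x) < eps) ->
    exists2 f, dom f &
      (fun n => norm1sq mu form (fun x => f_ n x - f x)) @ \oo --> (0 : R) }.

Definition form_extends (T : Type) (R : realType)
    (dom0 : set (T -> R[i])) (form0 : (T -> R[i]) -> (T -> R[i]) -> R[i])
    (dom : set (T -> R[i])) (form : (T -> R[i]) -> (T -> R[i]) -> R[i])
    : Prop :=
  dom0 `<=` dom /\
  forall f g, dom0 f -> dom0 g -> form f g = form0 f g.

Definition smallest_closed_extension d (T : measurableType d) (R : realType)
    (K : set R[i]) (mu : {measure set T -> \bar R})
    (dom0 : set (T -> R[i])) (form0 : (T -> R[i]) -> (T -> R[i]) -> R[i])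
    (dom : set (T -> R[i])) (form : (T -> R[i]) -> (T -> R[i]) -> R[i])
    : Prop :=
  [/\ closed_form K mu dom form,
      form_extends dom0 form0 dom form
    & forall dom' form', closed_form K mu dom' form' ->
        form_extends dom0 form0 dom' form' ->
        form_extends dom form dom' form'].

(* Square field operator of a Dirichlet form, with the normalization
   form f f = 1/2 \int Gam f f: the L^1-valued positive symmetric continuous
   bilinear map given on bounded functions of the domain by the identity
   sqf_id (it is unique up to mu-almost everywhere equality). *)
Record square_field_operator d (T : measurableType d) (R : realType)
    (K : set R[i]) (mu : {measure set T -> \bar R}) (dom : set (T -> R[i]))
    (form : (T -> R[i]) -> (T -> R[i]) -> R[i])
    (Gam : (T -> R[i]) -> (T -> R[i]) -> T -> R[i]) : Prop :=
    SquareFieldOperator {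
  sqf_L1 : forall f g, dom f -> dom g -> LfunK K mu 1%:E (Gam f g) ;
  sqf_sym : forall f g, dom f -> dom g ->
    {ae mu, forall x, Gam f g x = Gam g f x} ;
  sqf_lin : forall a f g h, K a -> dom f -> dom g -> dom h ->
    {ae mu, forall x, Gam (fun y => a * f y + g y) h x =
                      a * Gam f h x + Gam g h x} ;
  sqf_ge0 : forall f, dom f -> {ae mu, forall x, 0 <= Gam f (conjf f) x} ;
  sqf_continuous : forall (f_ g_ : nat -> T -> R[i]) (f g : T -> R[i]),
    (forall n, dom (f_ n)) -> (forall n, dom (g_ n)) -> dom f -> dom g ->
    (fun n => norm1sq mu form (fun x => f_ n x - f x)) @ \oo --> (0 : R) ->
    (fun n => norm1sq mu form (fun x => g_ n x - g x)) @ \oo --> (0 : R) ->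
    (fun n => \int[mu]_x modc (Gam (f_ n) (g_ n) x - Gam f g x))
      @ \oo --> (0 : R) ;
  sqf_id : forall f g h,
    dom f -> LfunK K mu +oo%E f -> dom g -> LfunK K mu +oo%E g ->
    dom h -> LfunK K mu +oo%E h ->
    form (fun x => f x * h x) g + form (fun x => g x * h x) f
      - form h (fun x => f x * g x)
    = cint mu (fun x => h x * Gam f g x) }.

Definition supp (R : realType) (G : R -> R) : set R :=
  closure [set x | G x != 0].

Definition Cc_infty (R : realType) (G : R -> R) : Prop :=
  (forall n x, derivable (derive1n n G) x 1) /\ compact (supp G).

Definition local_form (T : Type) (R : realType) (dom : set (T -> R[i]))
    (form : (T -> R[i]) -> (T -> R[i]) -> R[i]) : Prop :=
  forall f : T -> R, dom (toC f) ->
  forall G H : R -> R, Cc_infty G -> Cc_infty H ->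
  supp G `&` supp H = set0 ->
  form (toC (fun x => G (f x) - G 0)) (toC (fun x => H (f x) - H 0)) = 0.

Definition partial (R : realType) (p : nat) (F : 'rV[R]_p -> R) (i : 'I_p)
    : 'rV[R]_p -> R :=
  fun x => 'D_(delta_mx 0 i) F x.

Definition C1 (R : realType) (p : nat) (F : 'rV[R]_p -> R) : Prop :=
  (forall x, differentiable F x) /\ forall i, continuous (partial F i).

(* E[(phi(Z) - phi(Y)) (chi(Z) - chi(Y))] *)
Definition increment_form d d' (Omega : measurableType d)
    (E : measurableType d') (R : realType) (P : probability Omega R)
    (Z Y : {RV P >-> E}) (phi chi : E -> R[i]) : R[i] :=
  cint P (fun w => (phi (Z w) - phi (Y w)) * (chi (Z w) - chi (Y w))).

(* The limit of alpha_n / 2 E[(phi(Y_n) - phi(Y)) (chi(Y_n) - chi(Y))];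
   lim is a junk value when the sequence diverges. *)
Definition limit_form d d' (Omega : measurableType d)
    (E : measurableType d') (R : realType) (P : probability Omega R)
    (alpha : nat -> R) (Yn : nat -> {RV P >-> E}) (Y : {RV P >-> E})
    (phi chi : E -> R[i]) : R[i] :=
  lim ((fun n => (alpha n / 2)%:C * increment_form (Yn n) Y phi chi : R[i]^o)
         @ \oo).

(* Main.v *)
Require Import Defs.
From HB Require Import structures.
From mathcomp Require Import all_boot all_order all_algebra.
From mathcomp Require Import complex.
From mathcomp Require Import all_classical all_reals all_analysis.
From mathcomp Require Import measurable_realfun ess_sup_inf.
From mathcomp Require Import ring lra.
Import Order.TTheory GRing.Theory Num.Theory numFieldNormedType.Exports.

Local Open Scope classical_set_scope.
Local Open Scope ring_scope.
Local Open Scope complex_scope.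

(** For a function [k] on [E * E] put [J_n k = alpha_n E(k (Y_n, Y))], and for
    a function [g] on [E] put [delta g (x, y) = g x - g y]. For [f, g] in the
    real part of [D], the hypothesis says that [J_n (delta f * delta g)]
    converges, and its limit is [2 * form f g]. The theorem asks for the limit
    of [J_n] at the square of [delta (F o (f_1, ..., f_p))].

    To first order, [delta (F o f)] is the sum of the
    [(partial F i o f)(Y) * delta f_i], so that two facts suffice.

    The first fact is that the remainder is negligible ([remainder_cvg0]). As
    the partial derivatives are uniformly continuous on compact boxes, for
    every [e] there is a [C] such that the remainder is at most
    [(e + C |delta f|^2) |delta f|] ([taylor_remainder]). Its square is thus
    controlled by [e^2 |delta f|^2 + C' |delta f|^4]: the first term has a
    [J_n] of order [e^2], and the [J_n] of the second one tends to 0 by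
    [fourth_moment_cvg0].

    The second fact is that [J_n (u(Y) * delta f_i * delta f_j)] tends to the
    integral of [u * Gamma(f_i, f_j)] when [u] is a continuous function of the
    [f_k] ([carre_du_champ_closure]). For [u] in [D], expanding the identity
    that characterizes Gamma gives this limit with [u(Y_n) + u(Y)] in place of
    [2 u(Y)]; the difference is the [J_n] of a product of three increments,
    which vanishes again thanks to the fourth moments ([carre_du_champ]). The
    general case follows by uniform approximation, for which a Weierstrass
    theorem in several variables is proved ([weierstrass]).

    There remains to derive the fourth moments from locality. If [G] and [H]
    are nonnegative with disjoint supports, then
    [- delta (G o f) (x, y) * delta (H o f) (x, y)] equals
    [G(f x) H(f y) + G(f y) H(f x)], so that its [J_n] measures the jumps of
    [f] between both supports. If [G] and [H] are smooth bumps, locality says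
    that the form vanishes at [G o f] and [H o f], up to additive constants.
    The function [G o f] need not be in [D], but polynomials [P_k] that
    approximate [G] in the C^1 sense on the range of [f] yield functions
    [P_k o f] of [D] which form a Cauchy sequence for the norm of the form,
    since their increments are close to each other relative to [delta f].
    Closedness puts [G o f] in the domain, and the form is still given there by
    the limit of the [J_n] ([core_approx], [C1_calculus]).
    Hence the jumps of [f] between disjoint intervals are negligible, and
    finitely many pairs of bumps catch all jumps of size more than a given one
    ([fourth_power_le_bumps]), whereas for the small ones [(delta f)^4] is at
    most a small multiple of [(delta f)^2]. *)

Set Implicit Arguments.
Unset Strict Implicit.

(** * Limits by approximation and uniform continuity *)

Definition fun_algebra (R : realType) (T : Type) (A : set (T -> R)) : Prop :=
  [/\ forall c : R, A (fun=> c),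
      forall f g, A f -> A g -> A (fun t => f t + g t)
    & forall f g, A f -> A g -> A (fun t => f t * g t)].

Definition uniform_closure (R : realType) (T : Type) (A : set (T -> R)) :
    set (T -> R) :=
  [set g | forall e : R, 0 < e -> exists2 h, A h & forall t, `|g t - h t| <= e].

Section Limits.
Context {R : realType}.

(** The usual interchange of limits: [a] is uniformly close, for large
    indices, to sequences whose limits are close to [l]. *)
Lemma cvg_by_approximation (a : nat -> R) (l : R) :
  (forall e : R, 0 < e -> exists b : nat -> R, exists m : R,
     [/\ b @ \oo --> m, `|m - l| <= e & \forall n \near \oo, `|a n - b n| <= e]) ->
  a @ \oo --> l.
Proof.
move=> H; apply/cvgrPdist_le => e e0.
have e3 : 0 < e / 3 by lra.
have [b [m [bm ml ab]]] := H _ e3.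
move/cvgrPdist_le : bm => /(_ _ e3) bm.
near=> n.
have h1 : `|m - b n| <= e / 3 by near: n.
have h2 : `|a n - b n| <= e / 3 by near: n.
move: h1 h2 ml; rewrite !ler_norml => /andP[? ?] /andP[? ?] /andP[? ?]; lra.
Unshelve. all: by end_near.
Qed.

(** Uniform continuity with a quadratic modulus: a polynomial bound can be
    integrated term by term, so that neither the Bernstein estimate nor the
    Taylor estimate below has to separate small from large distances. *)
Lemma compact_modulus (p : nat) (u : 'rV[R]_p -> R) (A : set 'rV[R]_p) :
  compact A -> continuous u -> forall e : R, 0 < e ->
  exists C : R, 0 <= C /\ forall x y, A x -> A y ->
    `|u x - u y| <= e + C * \sum_j (x 0 j - y 0 j) ^+ 2.
Proof.
move=> cA cu e e0.
have e2 : 0 < e / 2 by lra.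
have /compact_near_coveringP nc := cA.
have : \forall d \near (0 : R)^'+, A `<=` [set x | forall y, `|x - y| < d -> `|u x - u y| <= e].
  apply: nc => x Ax.
  have /cvgrPdist_le /(_ _ e2) := cu x.
  move=> /nbhs_normP[r /= r0 xr].
  exists (ball x (r / 2), [set d | d < r / 2]) => /=.
    split; first by apply: nbhsx_ballx; lra.
    by apply: nbhs_right_lt; lra.
  move=> [x' d] /= [xx' dr] y x'y.
  have h1 : `|u x - u x'| <= e / 2.
    apply: xr => /=; move: xx'; rewrite -ball_normE /=; lra.
  have h2 : `|u x - u y| <= e / 2.
    apply: xr => /=; rewrite (_ : x - y = (x - x') + (x' - y)); last first.
      by rewrite addrA subrK.
    apply: (le_lt_trans (ler_normD _ _)).
    move: xx'; rewrite -ball_normE /=; lra.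
  move: h1 h2; rewrite !ler_norml => /andP[? ?] /andP[? ?]; lra.
move=> nd.
have [d d0 ud] : exists2 d : R, 0 < d &
    A `<=` [set x | forall y, `|x - y| < d -> `|u x - u y| <= e].
  near (0 : R)^'+ => d; exists d; last by near: d.
  by near: d; exact: nbhs_right_gt.
(* If some coordinates are at distance at least d, the sum of squares is at
   least d ^+ 2, and the oscillation 2 * B of u is absorbed by C. *)
have [B hB] : exists B : R, forall x, A x -> `|u x| <= B.
  have /compact_bounded[B [_ hB]] : compact (u @` A).
    by apply: continuous_compact => //; apply: continuous_subspaceT.
  exists (B + 1) => x Ax; apply: (hB (B + 1)); first by lra.
  by exists x.
exists (2 * `|B| / d ^+ 2); split.
  by rewrite divr_ge0 ?sqr_ge0// mulr_ge0.
move=> x y Ax Ay.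
have S0 : 0 <= \sum_j (x 0 j - y 0 j) ^+ 2 by apply: sumr_ge0 => j _; exact: sqr_ge0.
have [xy|xy] := ltP `|x - y| d.
  apply: (le_trans (ud x Ax y xy)); rewrite lerDl mulr_ge0// divr_ge0 ?sqr_ge0//.
have [j hj] : exists j, d <= `|x 0 j - y 0 j|.
  apply: contrapT => /forallNP nj.
  have : `|x - y| < d.
    suff : ball x d y by rewrite -ball_normE.
    split=> // i j; rewrite (ord1 i) -ball_normE /=.
    by have /negP := nj j; rewrite -ltNge.
  by rewrite ltNge xy.
have hS : d ^+ 2 <= \sum_j (x 0 j - y 0 j) ^+ 2.
  rewrite (bigD1 j)//= -[leLHS]addr0 lerD//; last by apply: sumr_ge0 => *; exact: sqr_ge0.
  by rewrite -[leRHS]real_normK ?num_real// lerXn2r ?nnegrE ?(ltW d0).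
have dd : 0 < d ^+ 2 by rewrite exprn_gt0.
apply: (@le_trans _ _ (2 * `|B|)).
  move: (hB _ Ax) (hB _ Ay) (ler_norm B).
  by rewrite !ler_norml => /andP[? ?] /andP[? ?] ?; apply/andP; split; lra.
have : 2 * `|B| <= 2 * `|B| / d ^+ 2 * \sum_j (x 0 j - y 0 j) ^+ 2.
  by rewrite mulrAC ler_pdivlMr// ler_wpM2l// mulr_ge0.
lra.
Unshelve. all: by end_near.
Qed.

End Limits.

(** * Weierstrass approximation in an algebra of functions *)
Section Weierstrass.
Context {R : realType}.

(** The expectation of [phi] at the end of a random walk started at [s] whose
    successive steps, indexed by [l], go along a coordinate [i] by [h] with
    probability [w i]. Bernstein polynomials in several variables are obtained
    by walking [n] times along each coordinate with step proportional to
    [1 / n]; the recursion replaces the computation with binomial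
    coefficients. *)
Fixpoint bernstein (p : nat) (w : 'I_p -> R) (h : R) (l : seq 'I_p)
    (phi : 'rV[R]_p -> R) (s : 'rV[R]_p) : R :=
  if l is i :: l' then
    w i * bernstein w h l' phi (s + h *: delta_mx 0 i)
    + (1 - w i) * bernstein w h l' phi s
  else phi s.

Lemma bernstein_le (p : nat) (w : 'I_p -> R) h l phi psi s :
  (forall i, 0 <= w i <= 1) -> (forall s, phi s <= psi s) ->
  bernstein w h l phi s <= bernstein w h l psi s.
Proof.
move=> w01 le; elim: l s => [|i l IH] s //=.
have /andP[? ?] := w01 i.
by apply: lerD; apply: ler_wpM2l => //; lra.
Qed.

(** Mean and variance of the walk: the steps being independent, squared
    displacements split into the squared bias and the variance, which is
    additive in the steps. *)
Lemma bernstein_quadratic (p : nat) (w : 'I_p -> R) h l (a b : R) (x s : 'rV_p) :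
  bernstein w h l (fun s => a + b * \sum_j (s 0 j - x 0 j) ^+ 2) s =
  a + b * \sum_j ((s 0 j + (count_mem j l)%:R * h * w j - x 0 j) ^+ 2
                  + (count_mem j l)%:R * h ^+ 2 * (w j * (1 - w j))).
Proof.
elim: l s => [|i l IH] s /=.
  by congr (_ + _ * _); apply: eq_bigr => j _; rewrite !mul0r !addr0.
rewrite !IH.
set S1 := \sum_j _; set S2 := \sum_j _; set S3 := \sum_j _.
suff -> : S3 = w i * S1 + (1 - w i) * S2 by ring.
rewrite /S1 /S2 /S3 !mulr_sumr -big_split/=; apply: eq_bigr => j _.
rewrite !mxE eqxx/= eq_sym natrD.
by have [->|_] := eqVneq i j; rewrite /= ?mulr1n ?mulr0n; ring.
Qed.

(** The walk has finitely many outcomes, whose probabilities are polynomials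
    in the weights. *)
Lemma bernstein_mem (T : Type) (A : set (T -> R)) (p : nat)
    (w : 'I_p -> T -> R) h l phi s :
  fun_algebra A -> (forall i, A (w i)) ->
  A (fun t => bernstein (fun i => w i t) h l phi s).
Proof.
move=> [Ac AD AM] Aw; elim: l s => [|i l IH] s /=; first exact: Ac.
apply: (AD); apply: (AM) => //.
have := AD _ _ (Ac 1) (AM _ _ (Ac (-1)) (Aw i)).
by congr A; apply/funext => t; rewrite mulN1r.
Qed.

Lemma box_compact (p : nat) (M : R) :
  compact [set x : 'rV[R]_p | forall j, `|x 0 j| <= M].
Proof.
have := @rV_compact R p (fun=> `[- M, M]%classic) (fun=> @segment_compact R (- M) M).
congr compact; apply/seteqP; split => x /= h j; move: (h j);
  by rewrite /= in_itv/= ler_norml.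
Qed.

(** Bernstein's proof: the walk is directed so that its mean end point is
    [f t], and its variance is of order [1 / n]; the quadratic modulus of
    continuity of [u] bounds the error by the variance. *)
Lemma weierstrass (T : Type) (A : set (T -> R)) (p : nat) (f : 'I_p -> T -> R)
    (M : R) (u : 'rV[R]_p -> R) :
  fun_algebra A -> (forall i, A (f i)) -> (forall i t, `|f i t| <= M) ->
  continuous u -> uniform_closure A (fun t => u (\row_i f i t)).
Proof.
move=> Aalg Af fM cu e e0.
have [Ac AD AM] := Aalg.
wlog M0 : M fM / 0 < M.
  move=> W; apply: (W (`|M| + 1)); last by rewrite ltr_wpDl.
  by move=> i t; rewrite (le_trans (fM i t))// (le_trans (ler_norm M))// lerDl.
have e2 : 0 < e / 2 by lra.
have [C [C0 hC]] := compact_modulus (@box_compact p M) cu e2.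
pose n := (Num.truncn (C * p%:R * M ^+ 2 / (e / 2))).+1.
have n0 : 0 < n%:R :> R by rewrite ltr0n.
have hn : C * p%:R * M ^+ 2 / n%:R <= e / 2.
  by rewrite ler_pdivrMr// [leRHS]mulrC -ler_pdivrMr//; apply/ltW/truncnS_gt.
(* The comparison of phi with quadratic functions is made at all points s, also
   outside the box where the modulus of continuity holds, whence the
   projection cl onto the box. *)
pose cl (a : R) := Num.max (- M) (Num.min M a).
have clM a : `|cl a| <= M.
  by rewrite ler_norml /cl le_max lexx/= ge_max ge_min lexx/= andbT; lra.
have cl1 a b : `|b| <= M -> (cl a - b) ^+ 2 <= (a - b) ^+ 2.
  rewrite ler_norml /cl => /andP[? ?].
  have [aM|aM] := leP M a.
    rewrite max_r; last by lra.
    by rewrite lerXn2r// ?nnegrE; lra.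
  have [aM'|aM'] := leP a (- M) => //.
  by rewrite -[leRHS]sqrrN -[leLHS]sqrrN lerXn2r// ?nnegrE; lra.
pose h := 2 * M / n%:R.
pose w (i : 'I_p) (t : T) := (f i t + M) / (2 * M).
have Aw i : A (w i).
  rewrite (_ : w i = fun t => (f i t + M) * (2 * M)^-1)//.
  by apply: AM (Ac _); apply: AD.
have w01 t i : 0 <= w i t <= 1.
  have := fM i t; rewrite ler_norml => /andP[? ?].
  by rewrite /w ler_pdivlMr ?ler_pdivrMr; lra.
pose l := flatten [seq nseq n j | j <- enum 'I_p].
have cl_l (j : 'I_p) : count_mem j l = n.
  rewrite /l count_flatten -map_comp sumnE big_map big_enum/= (bigD1 j)//=.
  rewrite count_nseq /= eqxx mul1n big1 ?addn0// => k kj.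
  by rewrite count_nseq /= (negPf kj).
pose phi (s : 'rV[R]_p) := u (\row_j cl (s 0 j)).
exists (fun t => bernstein (w^~ t) h l phi (const_mx (- M))).
  exact: bernstein_mem.
move=> t.
set x : 'rV_p := \row_i f i t.
have xM j : `|x 0 j| <= M by rewrite mxE.
have phiC s : `|phi s - u x| <= e / 2 + C * \sum_j (s 0 j - x 0 j) ^+ 2.
  have sM j : `|(\row_j cl (s 0 j)) 0 j| <= M by rewrite mxE.
  apply: le_trans (hC _ _ sM xM) _.
  rewrite lerD2l ler_wpM2l// ler_sum// => j _.
  by rewrite mxE; exact: cl1.
have var : C * \sum_j (((const_mx (- M) : 'rV_p) 0 j + (count_mem j l)%:R * h * w j t - x 0 j) ^+ 2
    + (count_mem j l)%:R * h ^+ 2 * (w j t * (1 - w j t))) <= e / 2.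
  apply: (le_trans _ hn).
  rewrite (_ : C * p%:R * M ^+ 2 / n%:R = C * (M ^+ 2 / n%:R *+ p)); last first.
    by rewrite -[X in _ = C * X]mulr_natl; ring.
  rewrite ler_wpM2l// -[X in _ *+ X]card_ord -sumr_const.
  apply: ler_sum => j _.
  rewrite cl_l !mxE.
  have -> : - M + n%:R * h * w j t - f j t = 0.
    by rewrite /h /w; field; rewrite pnatr_eq0/=; lra.
  have -> : n%:R * h ^+ 2 * (w j t * (1 - w j t)) =
      M ^+ 2 / n%:R * (4 * (w j t * (1 - w j t))).
    by rewrite /h; field; rewrite pnatr_eq0.
  rewrite expr0n/= add0r ler_piMr ?divr_ge0 ?sqr_ge0//.
  by have := sqr_ge0 (2 * w j t - 1); nra.
(* By monotonicity, it suffices to evaluate the walk on the quadratic bounds. *)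
have up : bernstein (w^~ t) h l phi (const_mx (- M)) <= u x + e.
  apply: (@le_trans _ _ (bernstein (w^~ t) h l
    (fun s => (u x + e / 2) + C * \sum_j (s 0 j - x 0 j) ^+ 2) (const_mx (- M)))).
    apply: bernstein_le => // s; move: (phiC s); rewrite ler_norml; lra.
  by rewrite bernstein_quadratic; lra.
have lo : u x - e <= bernstein (w^~ t) h l phi (const_mx (- M)).
  apply: (@le_trans _ _ (bernstein (w^~ t) h l
    (fun s => (u x - e / 2) + (- C) * \sum_j (s 0 j - x 0 j) ^+ 2) (const_mx (- M)))).
    by rewrite bernstein_quadratic mulNr; lra.
  apply: bernstein_le => // s; move: (phiC s); rewrite ler_norml mulNr; lra.
by rewrite ler_norml; lra.
Qed.

End Weierstrass.

(** * Polynomial approximation of a function together with its derivative *)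
Section PolynomialC1.
Context {R : realType}.

Lemma horner_mem (T : Type) (A : set (T -> R)) (f : T -> R) (p : {poly R}) :
  fun_algebra A -> A f -> A (fun t => p.[f t]).
Proof.
move=> [Ac AD AM] Af; elim/poly_ind: p => [|p c IH].
  by rewrite (_ : (fun _ => _) = fun=> 0)//; apply/funext => t; rewrite horner0.
rewrite (_ : (fun _ => _) = fun t => p.[f t] * f t + c).
  by apply: AD (Ac c); exact: AM.
by apply/funext => t; rewrite !hornerE.
Qed.

Lemma poly_antiderivative (q : {poly R}) : exists p : {poly R}, p^`()%R = q.
Proof.
exists (\poly_(i < (size q).+1) (q`_i.-1 / i%:R)).
apply/polyP => i; rewrite coef_deriv coef_poly ltnS /=.
case: ltnP => [iq|qi]; last by rewrite mul0rn nth_default.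
by rewrite -[LHS]mulr_natr mulfVK// pnatr_eq0.
Qed.

Lemma derivative_bounded_lipschitz (g dg : R -> R) (M e : R) :
  (forall x : R, is_derive x 1 g (dg x)) -> (forall x, `|x| <= M -> `|dg x| <= e) ->
  forall x y, `|x| <= M -> `|y| <= M -> `|g x - g y| <= e * `|x - y|.
Proof.
move=> gD dgM.
suff H x y : x <= y -> `|x| <= M -> `|y| <= M -> `|g x - g y| <= e * `|x - y|.
  move=> x y xM yM; have [xy|/ltW yx] := leP x y; first exact: H.
  by rewrite distrC [`|x - y|]distrC; exact: H.
move=> xy xM yM.
have gD' z : z \in `]x, y[%R -> is_derive z 1 g (dg z) by [].
have gc : {within `[x, y], continuous g}.
  apply: continuous_subspaceT => z; apply: differentiable_continuous.
  by apply/derivable1_diffP; have [] := gD z.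
have [c] := MVT_segment xy gD' gc.
rewrite in_itv/= => /andP[xc cy] eq.
rewrite distrC eq normrM [`|x - y|]distrC ler_wpM2r// dgM//.
by move: xM yM; rewrite !ler_norml; lra.
Qed.

(** Approximate the derivative uniformly and integrate. The second estimate is
    the C^1 closeness, in the form in which it passes to increments. *)
Lemma poly_C1_approx (G dG : R -> R) (M e : R) :
  (forall x : R, is_derive x 1 G (dG x)) -> continuous dG -> 0 < e ->
  exists p : {poly R}, forall x y, `|x| <= M -> `|y| <= M ->
    `|p.[x] - G x| <= e /\
    `|(p.[x] - G x) - (p.[y] - G y)| <= e * `|x - y|.
Proof.
move=> GD cG e0.
wlog M0 : M / 0 < M.
  move=> W; have [|p hp] := W (`|M| + 1); first by rewrite ltr_wpDl.
  exists p => x y xM yM; have ? := ler_norm M.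
  by apply: hp; lra.
(* On the subtype of [- M, M], polynomials are an algebra of functions that
   contains the bounded function sval. *)
pose T := {x : R | `|x| <= M}.
pose A := [set g : T -> R | exists p : {poly R}, forall t, g t = p.[sval t]].
have Aalg : fun_algebra A.
  split.
  - by move=> c; exists c%:P => t; rewrite hornerC.
  - by move=> g h [p hp] [q hq]; exists (p + q) => t; rewrite hornerD hp hq.
  - by move=> g h [p hp] [q hq]; exists (p * q) => t; rewrite hornerM hp hq.
pose e' := e / (M + 1).
have e'0 : 0 < e' by rewrite divr_gt0//; lra.
have e'e : e' <= e by rewrite ler_pdivrMr ?ler_peMr; lra.
have e'M : e' * M <= e by rewrite mulrAC ler_pdivrMr ?ler_wpM2l; lra.
have cu : continuous (fun v : 'rV[R]_1 => dG (v 0 0)).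
  by move=> v; apply: continuous_comp; [exact: coord_continuous|exact: cG].
have Asv (i : 'I_1) : A (fun t => sval t) by exists 'X => t; rewrite hornerX.
have sM (i : 'I_1) (t : T) : `|sval t| <= M by case: t.
have [g [q hq] hg] := weierstrass Aalg Asv sM cu e'0.
have [P PD] := poly_antiderivative q.
pose p := P + (G 0 - P.[0])%:P.
exists p.
pose r (x : R) := p.[x] - G x.
have rD (x : R) : is_derive x 1 r (q.[x] - dG x).
  rewrite /r; have -> : q.[x] = (p^`()%R).[x].
    by rewrite /p derivD derivC addr0 PD.
  exact: is_deriveB.
have rM x : `|x| <= M -> `|q.[x] - dG x| <= e'.
  move=> xM; have := hg (exist _ x xM).
  by rewrite mxE hq /= distrC.
have lip := derivative_bounded_lipschitz rD rM.
have r0 : r 0 = 0 by rewrite /r /p hornerD hornerC; ring.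
move=> x y xM yM; split.
  rewrite -/(r x) -[r x]subr0 -r0 (le_trans (lip _ _ _ _))// ?normr0 ?(ltW M0)//.
  by rewrite subr0 (le_trans _ e'M)// ler_wpM2l// ltW.
by rewrite -/(r x) -/(r y) (le_trans (lip _ _ _ _))// ler_wpM2r.
Qed.

End PolynomialC1.

(** * Smooth bump functions *)
Section Bumps.
Context {R : realType}.

(** The class of the functions [p(1/x) exp(- 1/x)], extended by 0 to the left
    of 0: it is stable under derivation, which makes its members smooth. *)
Definition flat (p : {poly R}) (x : R) : R :=
  if 0 < x then p.[x^-1] * expR (- x^-1) else 0.

Lemma poly_le_expR (p : {poly R}) :
  exists C : R, 0 <= C /\ forall t, 0 <= t -> `|p.[t]| <= C * expR t.
Proof.
exists (\sum_(i < size p) `|p`_i| * i`!%:R); split.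
  by apply: sumr_ge0 => i _; rewrite mulr_ge0.
move=> t t0; rewrite horner_coef mulr_suml.
apply: (le_trans (ler_norm_sum _ _ _)); apply: ler_sum => i _.
rewrite normrM -mulrA ler_wpM2l// ger0_norm ?exprn_ge0//.
have f0 (k : nat) : 0 < k`!%:R :> R by rewrite ltr0n fact_gt0.
case: (nat_of_ord i) => [|k]; first by rewrite expr0 fact0 mul1r -[leLHS]expR0 ler_expR.
rewrite mulrC -ler_pdivrMr//.
by have := expR_ge1Dxn k t0; have := ltr01 (R := R); lra.
Qed.

Lemma is_derive_sqr_bound (g : R -> R) (C : R) :
  (forall h, `|g h| <= C * h ^+ 2) -> is_derive (0 : R) 1 g 0.
Proof.
move=> gC.
have g0 : g 0 = 0 by apply/eqP; rewrite -normr_le0 (le_trans (gC 0))// expr0n mulr0.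
suff H : (fun h : R => h^-1 *: ((g \o shift 0) (h *: 1) - g 0)) @ 0^' --> (0 : R).
  by apply: DeriveDef; [apply: cvgP H|exact: cvg_lim H].
rewrite g0; apply/cvgr0Pnorm_le => e e0.
have C1 : 0 < `|C| + 1 by rewrite ltr_wpDl.
near=> h.
have h0 : h != 0 by near: h; exact: nbhs_dnbhs_neq.
have hn : 0 < `|h| by rewrite normr_gt0.
rewrite /= subr0 addr0 scaler1 /GRing.scale/= normrM normfV mulrC ler_pdivrMr//.
apply: (le_trans (gC h)).
rewrite -[h ^+ 2]real_normK ?num_real// expr2 mulrA ler_wpM2r//.
have he : `|h| <= e / (`|C| + 1).
  by near: h; apply: dnbhs0_le; exact: divr_gt0.
rewrite ler_pdivlMr// in he.
apply: le_trans he; rewrite [leRHS]mulrC ler_wpM2r//.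
by rewrite (le_trans (ler_norm C))// lerDl.
Unshelve. all: by end_near.
Qed.

Definition flat_deriv (p : {poly R}) : {poly R} := 'X^2 * (p - p^`()%R).

(** At 0, [q(t) exp(- t)] is bounded for [t >= 0] when [q] is ['X^2 * p], so
    that [flat p] is dominated by a multiple of the square. *)
Lemma is_derive_flat (p : {poly R}) (x : R) :
  is_derive x 1 (flat p) (flat (flat_deriv p) x).
Proof.
have [x0|x0|<-] := ltgtP 0 x.
- pose G := (fun y : R => p.[y^-1] * expR (- y^-1)).
  have near_eq : \forall y \near x, G y = flat p y.
    near=> y; rewrite /flat ifT//; near: y; exact: lt_nbhsr.
  apply: (near_eq_is_derive near_eq).
  have dV : is_derive x 1 (fun y : R => y^-1) (- x ^- 2).
    apply: is_derive_eq; first by apply: is_deriveV; rewrite gt_eqF.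
    by rewrite /GRing.scale /= mulr1.
  have d1 : is_derive x 1 (horner p \o (fun y : R => y^-1)) ((p^`()%R).[x^-1] * (- x ^- 2)).
    exact: is_derive1_comp.
  have d2 : is_derive x 1 (expR \o (fun y : R => - y^-1)) (expR (- x^-1) * (- (- x ^- 2))).
    apply: is_derive1_comp.
  rewrite (_ : G = (horner p \o (fun y : R => y^-1)) *
                   (expR \o (fun y : R => - y^-1)))//.
  apply: (is_derive_eq (is_deriveM d1 d2)).
  rewrite /flat x0 /flat_deriv hornerM hornerXn hornerD hornerN exprVn.
  by rewrite /GRing.scale /=; ring.
- have near_eq : \forall y \near x, (cst 0 : R -> R) y = flat p y.
    near=> y; rewrite /flat ifF//; apply/negbTE; rewrite -leNgt ltW//.
    by near: y; exact: lt_nbhsl.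
  apply: (near_eq_is_derive near_eq).
  by rewrite /flat ltNge (ltW x0)/=; exact: is_derive_cst.
have [C [C0 hC]] := poly_le_expR ('X^2 * p).
rewrite {2}/flat ltxx; apply: (@is_derive_sqr_bound _ C) => h.
rewrite /flat; case: ifPn => h0; last by rewrite normr0 mulr_ge0// sqr_ge0.
have hi : 0 <= h^-1 by rewrite invr_ge0 ltW.
have := hC _ hi; rewrite hornerM hornerXn normrM (ger0_norm (exprn_ge0 _ _))//.
rewrite normrM (ger0_norm (expR_ge0 _)) expRN => H.
rewrite ler_pdivrMr ?expR_gt0//.
have := ler_wpM2l (sqr_ge0 h) H.
rewrite mulrA -exprMn divff ?gt_eqF// expr1n mul1r => /le_trans; apply.
by rewrite mulrA [h ^+ 2 * C]mulrC.
Unshelve. all: by end_near.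
Qed.

(** The derivative of a product of a translated and of a reflected flat function
    is a sum of two such products, whence the closure under addition. *)
Inductive bump_like : (R -> R) -> Prop :=
| BumpProd a b p q : bump_like (fun x => flat p (x - a) * flat q (b - x))
| BumpSum f g : bump_like f -> bump_like g -> bump_like (fun x => f x + g x).

Lemma bump_like_derive f : bump_like f ->
  exists2 df, bump_like df & forall x : R, is_derive x 1 f (df x).
Proof.
elim=> [a b p q|{}f g _ [df bdf fD] _ [dg bdg gD]]; last first.
  by exists (fun x => df x + dg x) => [|x]; [exact: BumpSum|exact: is_deriveD].
exists (fun x => flat (flat_deriv p) (x - a) * flat q (b - x)
               + flat p (x - a) * flat (- flat_deriv q) (b - x)).
  by apply: BumpSum; exact: BumpProd.
move=> x.
have d1 : is_derive x 1 (flat p \o (fun y : R => y - a)) (flat (flat_deriv p) (x - a)).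
  have D : is_derive x 1 (fun y : R => y - a) 1.
    by apply: is_derive_eq; rewrite subr0.
  rewrite -[flat _ _]mulr1; apply: is_derive1_comp; exact: is_derive_flat.
have d2 : is_derive x 1 (flat q \o (fun y : R => b - y)) (- flat (flat_deriv q) (b - x)).
  have D : is_derive x 1 (fun y : R => b - y) (- 1).
    by apply: is_derive_eq; ring.
  rewrite -mulrN1; apply: is_derive1_comp; exact: is_derive_flat.
rewrite (_ : (fun _ => _) = (flat p \o (fun y : R => y - a)) *
                            (flat q \o (fun y : R => b - y)))//.
apply: (is_derive_eq (is_deriveM d1 d2)).
have -> : flat (- flat_deriv q) (b - x) = - flat (flat_deriv q) (b - x).
  by rewrite /flat; case: ifP => _; rewrite ?oppr0// hornerN mulNr.
by rewrite /GRing.scale /=; ring.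
Qed.

Lemma bump_like_smooth f : bump_like f ->
  forall n, bump_like (derive1n n f).
Proof.
move=> bf; elim=> [|n IH]//.
rewrite derive1nS; have [df bdf fD] := bump_like_derive IH.
rewrite (_ : derive1 _ = df)//; apply/funext => x.
by rewrite derive1E; apply: derive_val.
Qed.

Definition smooth_bump (a b x : R) : R := flat 1 (x - a) * flat 1 (b - x).

Lemma flat1_ge0 x : 0 <= flat 1 x.
Proof. by rewrite /flat; case: ifP => // _; rewrite hornerC mul1r expR_ge0. Qed.

Lemma bump_ge0 a b x : 0 <= smooth_bump a b x.
Proof. by rewrite mulr_ge0 // flat1_ge0. Qed.

Lemma bump_eq0 a b x : ~~ (a < x < b) -> smooth_bump a b x = 0.
Proof.
rewrite negb_and /smooth_bump /flat !subr_gt0 => /orP[/negPf ->|/negPf ->];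
  by rewrite ?mul0r ?mulr0.
Qed.

(** The lower bound is uniform in the position of the bump, as it only depends
    on the distance to both ends. *)
Lemma bump_lower (e : R) : 0 < e -> exists c : R, 0 < c /\
  forall a b x, a + e <= x <= b - e -> c <= smooth_bump a b x.
Proof.
move=> e0; exists (expR (- e^-1) * expR (- e^-1)).
split; first by rewrite mulr_gt0 ?expR_gt0.
have H y : e <= y -> expR (- e^-1) <= flat 1 y.
  move=> ey; rewrite /flat ifT ?(lt_le_trans e0)// hornerC mul1r ler_expR lerN2.
  by rewrite lef_pV2// posrE (lt_le_trans e0).
by move=> a b x /andP[? ?]; apply: ler_pM; rewrite ?expR_ge0// H; lra.
Qed.

Lemma bump_supp a b : supp (smooth_bump a b) `<=` `[a, b]%classic.
Proof.
have /closure_id -> : closed `[a, b]%classic by exact: itv_closed.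
apply: closure_subset => x /=; rewrite in_itv/=.
by apply: contraR => h; rewrite bump_eq0// negb_and -!leNgt; move: h;
  rewrite negb_and -!ltNge => /orP[/ltW ->|/ltW ->]; rewrite ?orbT.
Qed.

Lemma bump_like_bump a b : bump_like (smooth_bump a b).
Proof. exact: BumpProd. Qed.

Lemma bump_Cc_infty a b : Cc_infty (smooth_bump a b).
Proof.
split.
  move=> n x; have [df _ D] := bump_like_derive (bump_like_smooth (bump_like_bump a b) n).
  by have [] := D x.
apply: (@subclosed_compact _ _ `[a, b]%classic).
- exact: closed_closure.
- exact: segment_compact.
- exact: bump_supp.
Qed.

Lemma bump_C1 a b : exists2 dg : R -> R, continuous dg &
  forall x : R, is_derive x 1 (smooth_bump a b) (dg x).
Proof.
have [dg bdg D] := bump_like_derive (bump_like_bump a b); exists dg => // x.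
have [ddg _ DD] := bump_like_derive bdg.
apply: differentiable_continuous; apply/derivable1_diffP.
by have [] := DD x.
Qed.

End Bumps.

(** * Bumps detect large jumps *)
Section BigJumps.
Context {R : realType}.

(** The intervals [I k] have length [3 r], start at the points [- M - r + k r]
    of a grid, and their middle thirds cover [- M, M]. Points at distance more
    than [5 r = sqrt e] lie in middle thirds of indices that differ by at least
    4, and the corresponding intervals are disjoint; for closer points, the
    fourth power is at most [e] times the square. *)
Lemma fourth_power_le_bumps (M e : R) : 0 < M -> 0 < e ->
  exists C : R, exists N : nat, exists I : nat -> R * R,
  [/\ 0 <= C,
      forall k l, (k + 4 <= l)%N -> (I k).2 < (I l).1
    & forall x y, `|x| <= M -> `|y| <= M ->
      (x - y) ^+ 4 <= e * (x - y) ^+ 2 +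
        C * \sum_(k < N) \sum_(l < N | (k + 4 <= l)%N)
          (smooth_bump (I k).1 (I k).2 x * smooth_bump (I l).1 (I l).2 y +
           smooth_bump (I k).1 (I k).2 y * smooth_bump (I l).1 (I l).2 x)].
Proof.
move=> M0 e0.
pose r := Num.sqrt e / 5.
have r0 : 0 < r by rewrite divr_gt0// sqrtr_gt0.
have re : (5 * r) ^+ 2 = e.
  by rewrite /r mulrCA divff// mulr1 sqr_sqrtr// ltW.
have [c [c0 hc]] := bump_lower r0.
pose I (k : nat) : R * R := (- M + k%:R * r - r, - M + k%:R * r + 2 * r).
pose N := (Num.truncn (2 * M / r)).+1.
pose b k x := smooth_bump (I k).1 (I k).2 x.
have b0 k x : 0 <= b k x by exact: bump_ge0.
exists ((2 * M) ^+ 4 / c ^+ 2), N, I; split.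
- by rewrite divr_ge0// ?sqr_ge0// exprn_ge0//; lra.
- move=> k l kl; rewrite /I/=.
  have : k%:R * r + 4 * r <= l%:R * r.
    by rewrite -mulrDl ler_wpM2r ?(ltW r0)// -natrD ler_nat.
  lra.
pose S x y := \sum_(k < N) \sum_(l < N | (k + 4 <= l)%N) (b k x * b l y + b k y * b l x).
have T0 x y k l : 0 <= b k x * b l y + b k y * b l x.
  by rewrite addr_ge0// mulr_ge0.
have S0 x y : 0 <= S x y.
  by apply: sumr_ge0 => k _; apply: sumr_ge0 => l _; exact: T0.
suff H x y : x <= y -> `|x| <= M -> `|y| <= M -> (x - y) ^+ 4 <= e * (x - y) ^+ 2 +
    (2 * M) ^+ 4 / c ^+ 2 * S x y.
  move=> x y xM yM; rewrite -/(S x y); have [xy|/ltW yx] := leP x y; first exact: H.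
  have -> : S x y = S y x.
    by apply: eq_bigr => k _; apply: eq_bigr => l _; rewrite addrC.
  have -> : (x - y) ^+ 4 = (y - x) ^+ 4 by ring.
  have -> : (x - y) ^+ 2 = (y - x) ^+ 2 by ring.
  exact: H.
move=> xy xM yM.
have [small|big] := leP (y - x) (5 * r).
  apply: (@le_trans _ _ (e * (x - y) ^+ 2)).
    rewrite (_ : (x - y) ^+ 4 = (y - x) ^+ 2 * (x - y) ^+ 2); last by ring.
    by rewrite ler_wpM2r ?sqr_ge0// -re lerXn2r// nnegrE; lra.
  by rewrite lerDl mulr_ge0// divr_ge0 ?sqr_ge0// exprn_ge0//; lra.
have idx z : `|z| <= M -> exists k : 'I_N, k%:R * r <= z + M < k%:R * r + r.
  rewrite ler_norml => /andP[? ?].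
  have zM : 0 <= (z + M) / r by rewrite divr_ge0//; [lra|exact: ltW].
  have /andP[lo hi] := truncn_itv zM.
  have kN : (Num.truncn ((z + M) / r) < N)%N.
    rewrite ltnS; apply: le_truncn.
    by rewrite ler_pM2r ?invr_gt0//; lra.
  exists (Ordinal kN) => /=.
  by move: lo hi; rewrite ler_pdivlMr// ltr_pdivrMr// => -> /=; rewrite -addn1 natrD mulrDl mul1r.
have [k /andP[k1 k2]] := idx x xM.
have [l /andP[l1 l2]] := idx y yM.
have kl : (k + 4 <= l)%N.
  rewrite -ltnS -(ltr_nat R) natrD -[l.+1%:R]natr1.
  by rewrite -(ltr_pM2r r0) !mulrDl; lra.
have cS : c ^+ 2 <= S x y.
  have rest : 0 <= b k y * b l x +
      (\sum_(i < N | (k + 4 <= i)%N && (i != l)) (b k x * b i y + b k y * b i x) +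
       \sum_(i < N | i != k) \sum_(j < N | (i + 4 <= j)%N)
         (b i x * b j y + b i y * b j x)).
    apply: addr_ge0; first exact: mulr_ge0.
    apply: addr_ge0; apply: sumr_ge0 => i _; first exact: T0.
    by apply: sumr_ge0 => j _; exact: T0.
  rewrite /S (bigD1 k)//= (bigD1 l)//= -!addrA; apply: ler_wpDr => //.
  by rewrite expr2; apply: ler_pM; rewrite ?(ltW c0)// hc// /I/=; lra.
apply: (@le_trans _ _ ((2 * M) ^+ 4)).
  rewrite (_ : (x - y) ^+ 4 = (y - x) ^+ 4); last by ring.
  by move: xM yM; rewrite !ler_norml => *; rewrite lerXn2r// ?nnegrE; lra.
apply: (@le_trans _ _ ((2 * M) ^+ 4 / c ^+ 2 * S x y)).
  rewrite mulrAC ler_pdivlMr ?exprn_gt0// ler_wpM2l// exprn_ge0//; lra.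
by rewrite lerDr mulr_ge0 ?sqr_ge0 ?(ltW e0).
Qed.

End BigJumps.

(** * First order expansion of a function of several variables *)
Section Taylor.
Context {R : realType}.

Lemma derive_partial (p : nat) (F : 'rV[R]_p -> R) (z v : 'rV[R]_p) :
  differentiable F z -> 'D_v F z = \sum_i partial F i z * v 0 i.
Proof.
move=> dF; rewrite deriveE// {1}(row_sum_delta v) linear_sum.
apply: eq_bigr => i _; rewrite linearZ /GRing.scale/= mulrC.
by rewrite /partial deriveE.
Qed.

Lemma is_derive_line (p : nat) (F : 'rV[R]_p -> R) (x v : 'rV[R]_p) (t : R) :
  differentiable F (x + t *: v) ->
  is_derive t 1 (fun s : R => F (x + s *: v))
    (\sum_i partial F i (x + t *: v) * v 0 i).
Proof.
move=> dF; rewrite -derive_partial//.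
have E : (fun h : R => h^-1 *: (((fun s : R => F (x + s *: v)) \o shift t) (h *: 1)
      - F (x + t *: v))) =
    (fun h : R => h^-1 *: ((F \o shift (x + t *: v)) (h *: v) - F (x + t *: v))).
  apply/funext => h /=; congr (_ *: (F _ - _)).
  by rewrite scaler1 scalerDl addrCA.
have D := diff_derivable (v := v) dF.
by apply: DeriveDef; rewrite /derivable /derive E.
Qed.

(** Mean value theorem on the segment from [x] to [y], which stays in the box;
    the gap between partial derivatives is bounded by their quadratic
    modulus. *)
Lemma taylor_remainder (p : nat) (F : 'rV[R]_p -> R) (M e : R) :
  C1 F -> 0 < e -> exists C : R, 0 <= C /\
  forall x y : 'rV[R]_p, (forall j, `|x 0 j| <= M) -> (forall j, `|y 0 j| <= M) ->
  `|F y - F x - \sum_i partial F i x * (y 0 i - x 0 i)| <=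
  (e + C * \sum_j (y 0 j - x 0 j) ^+ 2) * \sum_i `|y 0 i - x 0 i|.
Proof.
move=> [dF cF] e0.
have /choice[K hK] : forall i, exists C : R, 0 <= C /\
    forall x y : 'rV[R]_p, (forall j, `|x 0 j| <= M) -> (forall j, `|y 0 j| <= M) ->
    `|partial F i x - partial F i y| <= e + C * \sum_j (x 0 j - y 0 j) ^+ 2.
  by move=> i; exact: compact_modulus (@box_compact R p M) (cF i) _ e0.
exists (\sum_i K i); split; first by apply: sumr_ge0 => i _; case: (hK i).
move=> x y xM yM.
set v := y - x.
pose g (t : R) := F (x + t *: v).
pose dg (t : R) := \sum_i partial F i (x + t *: v) * v 0 i.
have gD (t : R) : is_derive t 1 g (dg t) by apply: is_derive_line.
have gD' (t : R) : t \in `]0, 1[%R -> is_derive t 1 g (dg t) by [].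
have gc : {within `[0, 1], continuous g}.
  apply: continuous_subspaceT => z; apply: differentiable_continuous.
  by apply/derivable1_diffP; have [] := gD z.
have [c] := MVT_segment ler01 gD' gc.
rewrite in_itv/= => /andP[c0 c1].
have xv : x + v = y by rewrite /v addrC subrK.
rewrite /g scale1r scale0r addr0 subr0 mulr1 xv => ->; rewrite /dg.
set z := x + c *: v.
have zM j : `|z 0 j| <= M.
  rewrite !mxE; move: (xM j) (yM j); rewrite !ler_norml => /andP[? ?] /andP[? ?].
  by apply/andP; split; nra.
have zx j : (z 0 j - x 0 j) ^+ 2 <= (y 0 j - x 0 j) ^+ 2.
  rewrite !mxE; rewrite (_ : x 0 j + _ - _ = c * (y 0 j - x 0 j)); last by ring.
  by rewrite exprMn ler_piMl ?sqr_ge0//; nra.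
rewrite -sumrB mulr_sumr.
apply: (le_trans (ler_norm_sum _ _ _)); apply: ler_sum => i _.
have -> : v 0 i = y 0 i - x 0 i by rewrite !mxE.
rewrite -mulrBl normrM ler_wpM2r//.
have [Ki0 hKi] := hK i.
apply: (le_trans (hKi _ _ zM xM)); rewrite lerD2l.
apply: ler_pM => //.
- by apply: sumr_ge0 => j _; exact: sqr_ge0.
- rewrite (bigD1 i)//= lerDl; apply: sumr_ge0 => j _; by case: (hK j).
- by apply: ler_sum => j _; exact: zx.
Qed.

End Taylor.

(** * Real sequences and functions inside the complex ones *)
Section ComplexLimits.
Context {R : realType}.

Lemma normcR (x : R) : `|x%:C| = (`|x|)%:C :> R[i].
Proof. by rewrite normc_def /= expr0n addr0 sqrtr_sqr. Qed.

Lemma cvg_real_complex (u : nat -> R) (l : R) :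
  u @ \oo --> l -> (fun n => (u n)%:C) @ \oo --> (l%:C : R[i]^o).
Proof.
move=> /cvgrPdist_lt ul; apply/(@cvgrPdist_lt _ R[i]^o) => e.
rewrite ltcE /= => /andP[/eqP ime ree].
have := ul _ ree; apply: filterS => n h.
by rewrite -rmorphB normcR ltcE /= ime eqxx.
Qed.

Lemma cvg_complex_Re (v : nat -> R[i]) (z : R[i]) :
  v @ \oo --> (z : R[i]^o) -> (fun n => complex.Re (v n)) @ \oo --> complex.Re z.
Proof.
move=> /(@cvgrPdist_lt _ R[i]^o) vz; apply/cvgrPdist_lt => e e0.
have e0' : 0 < e%:C by rewrite ltcR.
have := vz _ e0'; apply: filterS => n h.
rewrite -ltcR -raddfB; exact: le_lt_trans (normc_ge_Re _) h.
Qed.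

End ComplexLimits.

(** * Bounded measurable functions *)
Section BoundedMeasurable.
Context {d} {T : measurableType d} {R : realType}.

Definition bounded_measurable (g : T -> R) : Prop :=
  measurable_fun setT g /\ exists M : R, forall x, `|g x| <= M.

Lemma bm_algebra : fun_algebra bounded_measurable.
Proof.
split.
- by move=> c; split => //; exists `|c|.
- move=> f g [mf [M fM]] [mg [N gN]]; split; first exact: measurable_funD.
  by exists (M + N) => x; rewrite (le_trans (ler_normD _ _))// lerD.
- move=> f g [mf [M fM]] [mg [N gN]]; split; first exact: measurable_funM.
  by exists (M * N) => x; rewrite normrM ler_pM.
Qed.

Lemma bm_cst (c : R) : bounded_measurable (fun=> c).
Proof. by case: bm_algebra => h _ _; exact: h. Qed.

Lemma bmD f g : bounded_measurable f -> bounded_measurable g ->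
  bounded_measurable (fun x => f x + g x).
Proof. by case: bm_algebra => _ h _; exact: h. Qed.

Lemma bmM f g : bounded_measurable f -> bounded_measurable g ->
  bounded_measurable (fun x => f x * g x).
Proof. by case: bm_algebra => _ _ h; exact: h. Qed.

Lemma bmN f : bounded_measurable f -> bounded_measurable (fun x => - f x).
Proof.
by move=> bf; rewrite (_ : (fun _ => _) = fun x => -1 * f x);
  [exact: bmM (bm_cst _) bf|apply/funext => x; rewrite mulN1r].
Qed.

Lemma bmB f g : bounded_measurable f -> bounded_measurable g ->
  bounded_measurable (fun x => f x - g x).
Proof. by move=> bf bg; apply: bmD => //; exact: bmN. Qed.

Lemma bmX f n : bounded_measurable f -> bounded_measurable (fun x => f x ^+ n).
Proof.
move=> bf; elim: n => [|n IH].
  by rewrite (_ : (fun _ => _) = fun=> 1); [exact: bm_cst|apply/funext => x; rewrite expr0].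
rewrite (_ : (fun _ => _) = fun x => f x * f x ^+ n); first exact: bmM.
by apply/funext => x; rewrite exprS.
Qed.

Lemma bm_sum (I : Type) (s : seq I) (Q : pred I) (f : I -> T -> R) :
  (forall i, bounded_measurable (f i)) ->
  bounded_measurable (fun x => \sum_(i <- s | Q i) f i x).
Proof.
move=> bf; elim: s => [|i s IH].
  by rewrite (_ : (fun _ => _) = fun=> 0); [exact: bm_cst|apply/funext => x; rewrite big_nil].
rewrite (_ : (fun _ => _) = fun x => (if Q i then f i x else 0) + \sum_(i <- s | Q i) f i x).
  by apply: bmD => //; case: (Q i) => //; exact: bm_cst.
by apply/funext => x; rewrite big_cons; case: ifP; rewrite ?add0r.
Qed.

Lemma bm_uniform_closure g : uniform_closure bounded_measurable g ->
  bounded_measurable g.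
Proof.
move=> ug; split; last first.
  have [h [_ [M hM]] gh] := ug 1 ltr01; exists (1 + M) => x.
  by rewrite -(subrK (h x) (g x)) (le_trans (ler_normD _ _))// lerD.
have /choice[h hh] : forall n, exists h, bounded_measurable h /\
    forall x, `|g x - h x| <= n.+1%:R^-1.
  by move=> n; have [|h bh gh] := ug n.+1%:R^-1; [rewrite invr_gt0|exists h].
apply: (@measurable_fun_cvg _ _ _ _ h) => [n|x _]; first by have [[]] := hh n.
apply/cvgrPdist_le => e e0; near=> n.
rewrite (le_trans ((hh n).2 x))//; near: n; apply: filterS (near_infty_natSinv_lt (PosNum e0)) => m; exact: ltW.
Unshelve. all: by end_near.
Qed.

Lemma bm_integrable (mu : {measure set T -> \bar R}) f :
  (mu setT < +oo)%E -> bounded_measurable f -> mu.-integrable setT (EFin \o f).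
Proof.
move=> mufin [mf [M fM]]; apply: measurable_bounded_integrable => //.
exists M; split; first exact: num_real.
by move=> r Mr x _ /=; apply: le_trans (fM x) _; exact: ltW.
Qed.

Lemma bm_Lfun (mu : {measure set T -> \bar R}) f (q : \bar R) : (1 <= q)%E ->
  (mu setT < +oo)%E -> bounded_measurable f -> f \in Lfun mu q.
Proof.
move=> q1 mufin [mf [M fM]].
apply: (@Lfun_subset _ _ _ mu q +oo%E) => //.
- exact: leey.
- by rewrite ge0_fin_numE.
- exact: leey.
rewrite inE; apply/andP; split; rewrite inE//=.
rewrite /finite_norm unlock /Lnorm; case: ifPn => // _.
apply: (@le_lt_trans _ _ M%:E); last exact: ltry.
by apply/ess_supP/nearW => x /=; rewrite lee_fin.
Qed.

Lemma bm_LfunK (mu : {measure set T -> \bar R}) (K : set R[i]) f (q : \bar R) :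
  real_or_complex K -> (1 <= q)%E ->
  (mu setT < +oo)%E -> bounded_measurable f -> LfunK K mu q (toC f).
Proof.
move=> K_field q1 mufin bf; split.
- by move=> x; case: K_field => ->.
- exact: bm_Lfun.
- exact: bm_Lfun (bm_cst _).
Qed.

Lemma cint_toC (mu : {measure set T -> \bar R}) (f : T -> R) :
  cint mu (toC f) = (\int[mu]_x f x)%:C.
Proof.
rewrite /cint /toC /=; congr Complex.
by rewrite Rintegral_cst// mul0r.
Qed.

End BoundedMeasurable.

(** * The functionals J_n *)
Section ScaledMean.
Context {d d'} {Omega : measurableType d} {E : measurableType d'} {R : realType}.
Context (P : probability Omega R) (Yn : nat -> {RV P >-> E}) (Y : {RV P >-> E}).
Context (alpha : nat -> R) (alpha_gt0 : forall n, 0 < alpha n).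

Definition scaled_mean (n : nat) (k : E * E -> R) : R :=
  alpha n * \int[P]_w k (Yn n w, Y w).

Lemma bm_pair n (k : E * E -> R) : bounded_measurable k ->
  bounded_measurable (fun w => k (Yn n w, Y w)).
Proof.
move=> [mk [M kM]]; split; last by exists M.
apply: measurableT_comp => //.
by apply: measurable_fun_pair; exact: measurable_funPT.
Qed.

Lemma bm_fst (g : E -> R) : bounded_measurable g ->
  bounded_measurable (fun z : E * E => g z.1).
Proof.
move=> [mg [M gM]]; split; last by exists M.
by apply: measurableT_comp => //; exact: measurable_fst.
Qed.

Lemma bm_snd (g : E -> R) : bounded_measurable g ->
  bounded_measurable (fun z : E * E => g z.2).
Proof.
move=> [mg [M gM]]; split; last by exists M.
by apply: measurableT_comp => //; exact: measurable_snd.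
Qed.

Definition delta (g : E -> R) (z : E * E) : R := g z.1 - g z.2.

Lemma bm_delta g : bounded_measurable g -> bounded_measurable (delta g).
Proof. by move=> bg; apply: bmB; [exact: bm_fst|exact: bm_snd]. Qed.

Lemma P_fin : (P setT < +oo)%E.
Proof. by rewrite probability_setT ltry. Qed.

Let int n k : bounded_measurable k ->
  P.-integrable setT (EFin \o (fun w => k (Yn n w, Y w))).
Proof. by move=> bk; apply: bm_integrable P_fin _; exact: bm_pair. Qed.

Lemma scaled_meanD n j k : bounded_measurable j -> bounded_measurable k ->
  scaled_mean n (fun z => j z + k z) = scaled_mean n j + scaled_mean n k.
Proof.
move=> bj bk; rewrite /scaled_mean -mulrDr; congr (_ * _).
by apply: RintegralD => //; exact: int.
Qed.

Lemma scaled_meanZ n c k : bounded_measurable k ->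
  scaled_mean n (fun z => c * k z) = c * scaled_mean n k.
Proof.
move=> bk; rewrite /scaled_mean mulrCA; congr (_ * _).
by apply: RintegralZl => //; exact: int.
Qed.

Lemma scaled_meanB n j k : bounded_measurable j -> bounded_measurable k ->
  scaled_mean n (fun z => j z - k z) = scaled_mean n j - scaled_mean n k.
Proof.
move=> bj bk; rewrite /scaled_mean -mulrBr; congr (_ * _).
by apply: RintegralB => //; exact: int.
Qed.

Lemma scaled_mean_sum n (I : Type) (s : seq I) (Q : pred I) (k : I -> E * E -> R) :
  (forall i, bounded_measurable (k i)) ->
  scaled_mean n (fun z => \sum_(i <- s | Q i) k i z) =
  \sum_(i <- s | Q i) scaled_mean n (k i).
Proof.
move=> bk; elim: s => [|i s IH].
  rewrite big_nil (_ : (fun _ => _) = fun z => 0 * 0).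
    by rewrite scaled_meanZ ?mul0r//; exact: bm_cst.
  by apply/funext => z; rewrite big_nil mul0r.
rewrite big_cons -IH; case: ifP => Qi.
  rewrite -scaled_meanD//; last exact: bm_sum.
  by congr scaled_mean; apply/funext => z; rewrite big_cons Qi.
by congr scaled_mean; apply/funext => z; rewrite big_cons Qi.
Qed.

Lemma le_scaled_mean n j k : bounded_measurable j -> bounded_measurable k ->
  (forall z, j z <= k z) -> scaled_mean n j <= scaled_mean n k.
Proof.
move=> bj bk jk; rewrite /scaled_mean ler_wpM2l ?(ltW (alpha_gt0 n))//.
by apply: le_Rintegral => //; [exact: int|exact: int].
Qed.

Lemma norm_scaled_mean_le n j k : bounded_measurable j -> bounded_measurable k ->
  (forall z, `|j z| <= k z) -> `|scaled_mean n j| <= scaled_mean n k.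
Proof.
move=> bj bk jk; rewrite ler_norml; apply/andP; split.
  rewrite lerNl -mulN1r -scaled_meanZ//; apply: le_scaled_mean => //.
    by apply: bmM bj; exact: bm_cst.
  by move=> z; rewrite mulN1r; have := jk z; rewrite ler_norml; lra.
by apply: le_scaled_mean => // z; have := jk z; rewrite ler_norml; lra.
Qed.

End ScaledMean.

(** * Square integrable functions and integration of finite sums *)
Section SquareIntegrable.
Context {d} {T : measurableType d} {R : realType} (mu : {measure set T -> \bar R}).

Lemma modc_sqr (z : R[i]) : modc z ^+ 2 = complex.Re z ^+ 2 + complex.Im z ^+ 2.
Proof. by rewrite /modc normc_def /= sqr_sqrtr// addr_ge0 ?sqr_ge0. Qed.

Lemma modc_sqr_sub_le (a b c : R[i]) :
  modc (a - c) ^+ 2 <= 2 * modc (b - a) ^+ 2 + 2 * modc (b - c) ^+ 2.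
Proof.
rewrite !modc_sqr; case: a b c => [a a'] [b b'] [c c'] /=.
by have := sqr_ge0 ((b - a) + (b - c)); have := sqr_ge0 ((b' - a') + (b' - c')); nra.
Qed.

Lemma integrable_modc_sqr (K : set R[i]) (u v : T -> R[i]) :
  LfunK K mu 2%:E u -> LfunK K mu 2%:E v ->
  mu.-integrable setT (EFin \o (fun x => modc (u x - v x) ^+ 2)).
Proof.
move=> [_ ru iu] [_ rv iv].
have two : (1 <= 2%:E :> \bar R)%E by rewrite lee_fin; lra.
have r : ((fun x => complex.Re (u x)) - (fun x => complex.Re (v x)))%R \in Lfun mu 2%:E.
  by rewrite rpredB.
have i : ((fun x => complex.Im (u x)) - (fun x => complex.Im (v x)))%R \in Lfun mu 2%:E.
  by rewrite rpredB.
have := integrableD measurableT (Lfun2_integrable_sqr r) (Lfun2_integrable_sqr i).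
congr (_.-integrable _ _); apply/funext => x /=.
by rewrite modc_sqr -EFinD !raddfB.
Qed.

Lemma modc_sqr_int0_ae (K : set R[i]) (u v : T -> R[i]) :
  LfunK K mu 2%:E u -> LfunK K mu 2%:E v ->
  \int[mu]_x (modc (u x - v x) ^+ 2) = 0 -> {ae mu, forall x, u x = v x}.
Proof.
move=> uL vL int0.
have ig := integrable_modc_sqr uL vL.
have mg := measurable_int mu ig.
have : (\int[mu]_x `|(modc (u x - v x) ^+ 2)%:E| = 0)%E.
  under eq_integral do rewrite /= ger0_norm ?sqr_ge0//.
  rewrite -[LHS]fineK; last exact: (integrable_fin_num measurableT ig).
  by rewrite -[fine _]/(\int[mu]_x (modc (u x - v x) ^+ 2)) int0.
move=> /(ae_eq_integral_abs mu measurableT mg); apply: filterS => x /(_ I) /=.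
move=> [] /eqP; rewrite modc_sqr paddr_eq0 ?sqr_ge0// !sqrf_eq0.
move=> /andP[/eqP re0 /eqP im0]; apply/eqP; rewrite -subr_eq0 eq_complex.
by rewrite re0 im0 !eqxx.
Qed.

Lemma integrable_realZ (f : T -> R) (c : R) :
  mu.-integrable setT (EFin \o f) ->
  mu.-integrable setT (EFin \o (fun x => c * f x)).
Proof. by move=> /(integrableZl measurableT c); congr (_.-integrable _ _). Qed.

Lemma integrable_realD (f g : T -> R) :
  mu.-integrable setT (EFin \o f) -> mu.-integrable setT (EFin \o g) ->
  mu.-integrable setT (EFin \o (fun x => f x + g x)).
Proof.
by move=> fi gi; have := integrableD measurableT fi gi; congr (_.-integrable _ _).
Qed.

Lemma integrable_bmM (f g : T -> R) :
  bounded_measurable f -> mu.-integrable setT (EFin \o g) ->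
  mu.-integrable setT (EFin \o (fun x => f x * g x)).
Proof.
move=> [mf [M fM]] gi.
have fb : [bounded f x | x in setT].
  exists M; split; first exact: num_real.
  by move=> r Mr x _ /=; apply: le_trans (fM x) _; exact: ltW.
by have := integrableMr measurableT mf fb gi; congr (_.-integrable _ _).
Qed.

Lemma integrable_real_sum (I : Type) (s : seq I) (f : I -> T -> R) :
  (forall i, mu.-integrable setT (EFin \o f i)) ->
  mu.-integrable setT (EFin \o (fun x => \sum_(i <- s) f i x)).
Proof.
move=> fi; elim: s => [|i s IH].
  rewrite (_ : _ \o _ = cst 0%E); first exact: integrable0.
  by apply/funext => x /=; rewrite big_nil.
rewrite (_ : (fun x => _) = fun x => f i x + \sum_(i <- s) f i x).
  exact: integrable_realD.
by apply/funext => x; rewrite big_cons.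
Qed.

Lemma Rintegral_sum (I : Type) (s : seq I) (f : I -> T -> R) :
  (forall i, mu.-integrable setT (EFin \o f i)) ->
  \int[mu]_x (\sum_(i <- s) f i x) = \sum_(i <- s) \int[mu]_x f i x.
Proof.
move=> fi; elim: s => [|i s IH].
  rewrite big_nil (_ : (fun x => _) = cst 0).
    by rewrite Rintegral_cst// mul0r.
  by apply/funext => x; rewrite big_nil.
rewrite big_cons -IH -RintegralD//; last exact: integrable_real_sum.
by congr Rintegral; apply/funext => x; rewrite big_cons.
Qed.

End SquareIntegrable.

(** * Limits of nonnegative sequences and of finite sums *)
Section Sequences.
Context {R : realType}.

Lemma cvg0_approx (a : nat -> R) : (forall n, 0 <= a n) ->
  (forall e : R, 0 < e -> exists b : nat -> R, exists m : R,
    [/\ b @ \oo --> m, m <= e & forall n, a n <= b n]) ->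
  a @ \oo --> (0 : R).
Proof.
move=> a0 H; apply/cvgr0Pnorm_le => e e0.
have e2 : 0 < e / 2 by lra.
have [b [m [/cvgrPdist_le /(_ _ e2) bm me ab]]] := H _ e2.
apply: filterS bm => n; rewrite ler_norml => /andP[? _].
by rewrite ger0_norm//; have := ab n; lra.
Qed.

Lemma cvg_finite_sum (I : Type) (s : seq I) (Q : pred I) (u : I -> nat -> R)
    (l : I -> R) : (forall i, Q i -> u i @ \oo --> l i) ->
  (fun n => \sum_(i <- s | Q i) u i n) @ \oo --> \sum_(i <- s | Q i) l i.
Proof.
move=> ul; elim: s => [|i s IH].
  rewrite big_nil (_ : (fun n => _) = fun=> 0); first exact: cvg_cst.
  by apply/funext => n; rewrite big_nil.
rewrite big_cons; case: ifPn => Qi.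
  rewrite (_ : (fun n => _) = fun n => u i n + \sum_(i <- s | Q i) u i n).
    by apply: cvgD => //; exact: ul.
  by apply/funext => n; rewrite big_cons Qi.
rewrite (_ : (fun n => _) = fun n => \sum_(i <- s | Q i) u i n)//.
by apply/funext => n; rewrite big_cons (negbTE Qi).
Qed.

End Sequences.

(** * The form on real functions *)
Section Energy.
Context {R : realType} {d d' : measure_display}.
Context {Omega : measurableType d} {E : measurableType d'}.
Context (P : probability Omega R) (Y : {RV P >-> E}) (Yn : nat -> {RV P >-> E}).
Context (alpha : nat -> R) (alpha_gt0 : forall n, 0 < alpha n).
Context (K : set R[i]) (K_field : real_or_complex K).
Context (D : set (E -> R[i])) (D_alg : bounded_algebra K D).
Context (generator : forall phi, D phi ->
  exists2 A, LfunK K (distribution P Y) 2%:E A &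
  forall chi, D chi ->
    (fun n => (alpha n)%:C * increment_form (Yn n) Y phi chi) @ \oo -->
    (- 2 * cint (distribution P Y) (fun x => A x * chi x) : R[i]^o)).
Context (dom : set (E -> R[i])) (form : (E -> R[i]) -> (E -> R[i]) -> R[i]).
Context (form_closed : closed_form K (distribution P Y) dom form).
Context (form_ext : form_extends D (limit_form alpha Yn Y) dom form).

Local Notation nu := (distribution P Y).
Local Notation J := (scaled_mean Yn Y alpha).

Definition real_part : set (E -> R) := [set f | D (toC f)].

Lemma real_scalar (c : R) : K c%:C.
Proof. by case: K_field => ->. Qed.

Lemma real_part_algebra : fun_algebra real_part.
Proof.
split.
- by move=> c; exact: (alg_cst D_alg (real_scalar c)).
- move=> f g Df Dg; rewrite /real_part/= (_ : toC _ = fun x => toC f x + toC g x).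
    exact: (alg_add D_alg Df Dg).
  by apply/funext => x; rewrite /toC rmorphD.
- move=> f g Df Dg; rewrite /real_part/= (_ : toC _ = fun x => toC f x * toC g x).
    exact: (alg_mul D_alg Df Dg).
  by apply/funext => x; rewrite /toC rmorphM.
Qed.

Lemma real_part_bm f : real_part f -> bounded_measurable f.
Proof.
move=> Df; split; first by have [] := alg_measurable D_alg Df.
have [M fM] := alg_bounded D_alg Df; exists M => x.
by have := fM x; rewrite /modc /toC normcR.
Qed.

Lemma nu_fin : (nu setT < +oo)%E.
Proof. by rewrite probability_setT ltry. Qed.

Definition energy (f g : E -> R) : R := complex.Re (form (toC f) (toC g)).

Lemma scaled_increment_form (f g : E -> R) n :
  (alpha n)%:C * increment_form (Yn n) Y (toC f) (toC g) =
  (J n (fun z => delta f z * delta g z))%:C.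
Proof.
rewrite /scaled_mean rmorphM /=; congr (_ * _); rewrite -cint_toC; congr cint.
by apply/funext => w; rewrite /toC /delta !rmorphM !rmorphB.
Qed.

(** On [D], the form is the limit that defines it, and [lim] is not a junk value
    there, because the hypothesis on the generator ensures convergence. *)
Lemma energy_core (f g : E -> R) : real_part f -> real_part g ->
  form (toC f) (toC g) = (energy f g)%:C /\
  (fun n => J n (fun z => delta f z * delta g z)) @ \oo --> 2 * energy f g.
Proof.
move=> Df Dg.
have [A _ /(_ _ Dg)] := generator Df.
set z := - 2 * _ => vz.
have Jz : (fun n => J n (fun z => delta f z * delta g z)) @ \oo --> complex.Re z.
  have -> : (fun n => J n (fun z => delta f z * delta g z)) = (fun n =>
      complex.Re ((alpha n)%:C * increment_form (Yn n) Y (toC f) (toC g))).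
    by apply/funext => n; rewrite scaled_increment_form.
  exact: cvg_complex_Re.
have formE : form (toC f) (toC g) = (complex.Re z / 2)%:C.
  have h : (fun n => J n (fun z => delta f z * delta g z) / 2) @ \oo --> complex.Re z / 2.
    exact: cvgMr_tmp.
  have [_ ->//] := form_ext; rewrite /limit_form.
  have -> : (fun n => (alpha n / 2)%:C * increment_form (Yn n) Y (toC f) (toC g)) =
      (fun n => (J n (fun z => delta f z * delta g z) / 2)%:C).
    apply/funext => n.
    by rewrite rmorphM mulrAC scaled_increment_form -rmorphM.
  exact: (cvg_lim (@norm_hausdorff _ R[i]^o) (cvg_real_complex h)).
have eE : energy f g = complex.Re z / 2 by rewrite /energy formE.
by rewrite formE eE mulrCA divff// mulr1.
Qed.

Definition real_dom : set (E -> R) := [set f | dom (toC f)].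

Lemma real_part_dom f : real_part f -> real_dom f.
Proof. by case: form_ext => h _ /h. Qed.

Lemma toC_linear (a : R) f g :
  toC (fun x => a * f x + g x) = (fun x => a%:C * toC f x + toC g x) :> (E -> R[i]).
Proof. by apply/funext => x; rewrite /toC rmorphD rmorphM. Qed.

Lemma real_dom_lin (a : R) f g : real_dom f -> real_dom g ->
  real_dom (fun x => a * f x + g x).
Proof.
move=> df dg; rewrite /real_dom /= toC_linear.
exact: dom_lin form_closed _ _ _ (real_scalar a) df dg.
Qed.

Lemma energy_sym f g : real_dom f -> real_dom g -> energy f g = energy g f.
Proof. by move=> df dg; rewrite /energy (form_sym form_closed). Qed.

Lemma energy_linl (a : R) f g h : real_dom f -> real_dom g -> real_dom h ->
  energy (fun x => a * f x + g x) h = a * energy f h + energy g h.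
Proof.
move=> df dg dh; rewrite /energy toC_linear.
rewrite (form_lin form_closed (real_scalar a) df dg dh) raddfD /=.
by case: (form _ _) => r s; rewrite /= mul0r subr0.
Qed.

Lemma conjf_toC (f : E -> R) : conjf (toC f) = toC f.
Proof. by apply/funext => x; rewrite /conjf /toC /= oppr0. Qed.

Lemma energy_ge0 f : real_dom f -> 0 <= energy f f.
Proof.
move=> df; have := form_ge0 form_closed df.
by rewrite conjf_toC lecE => /andP[].
Qed.

(** Cauchy-Schwarz in the form of Young's inequality, from the positivity of
    the energy at [f + s g] and [f - s g]. *)
Lemma energy_young f g (s : R) : 0 < s -> real_dom f -> real_dom g ->
  `|energy f g| <= (energy f f / s + s * energy g g) / 2.
Proof.
move=> s0 df dg.
have expand (a : R) : energy (fun x => a * g x + f x) (fun x => a * g x + f x) =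
    a ^+ 2 * energy g g + 2 * a * energy f g + energy f f.
  have dh := real_dom_lin a dg df.
  rewrite energy_linl// [X in a * X](energy_sym dg dh) [X in _ + X](energy_sym df dh).
  by rewrite !energy_linl// (energy_sym dg df); ring.
have pos a : 0 <= a ^+ 2 * energy g g + 2 * a * energy f g + energy f f.
  by rewrite -expand; apply: energy_ge0; exact: real_dom_lin.
have sV : s * s^-1 = 1 by rewrite divff// gt_eqF.
have Q1 : 0 <= s * energy g g + 2 * energy f g + energy f f / s.
  rewrite (_ : _ + _ = (s ^+ 2 * energy g g + 2 * s * energy f g + energy f f) / s).
    by rewrite divr_ge0// ltW.
  by field; rewrite gt_eqF.
have Q2 : 0 <= s * energy g g - 2 * energy f g + energy f f / s.
  rewrite (_ : _ + _ = ((- s) ^+ 2 * energy g g + 2 * (- s) * energy f g + energy f f) / s).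
    by rewrite divr_ge0// ltW.
  by field; rewrite gt_eqF.
by rewrite ler_norml; lra.
Qed.

Lemma energy_cvg0 (u : nat -> E -> R) g : (forall k, real_dom (u k)) -> real_dom g ->
  (fun k => energy (u k) (u k)) @ \oo --> (0 : R) ->
  (fun k => energy (u k) g) @ \oo --> (0 : R).
Proof.
move=> du dg u0; apply/cvgr0Pnorm_le.
suff : (fun k => `|energy (u k) g|) @ \oo --> (0 : R).
  by move=> /cvgr0Pnorm_le H e e0; have := H e e0; apply: filterS => k; rewrite normr_id.
apply: cvg0_approx => // e e0.
have q1 : 0 < energy g g + 1 by have := energy_ge0 dg; lra.
pose s := e / (energy g g + 1).
have s0 : 0 < s by rewrite divr_gt0.
exists (fun k => (energy (u k) (u k) / s + s * energy g g) / 2), ((0 / s + s * energy g g) / 2); split.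
- apply: cvgMr_tmp; apply: cvgD; last exact: cvg_cst.
  exact: cvgMr_tmp.
- rewrite mul0r add0r.
  have : s * energy g g <= e.
    by rewrite /s mulrAC ler_pdivrMr// ler_wpM2l ?(ltW e0)//; lra.
  lra.
- by move=> k; exact: energy_young.
Qed.

Lemma one_le2 : (1 <= 2%:E :> \bar R)%E.
Proof. by rewrite lee_fin; lra. Qed.

Lemma dom_sub f g : dom f -> dom g -> dom (fun x => f x - g x).
Proof.
move=> df dg; rewrite (_ : (fun _ => _) = fun x => (-1)%:C * g x + f x).
  exact: (dom_lin form_closed (real_scalar (-1)) dg df).
by apply/funext => x; rewrite rmorphN rmorph1 mulN1r addrC.
Qed.

Lemma toC_sub (f g : E -> R) :
  toC (fun x => f x - g x) = (fun x => toC f x - toC g x).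
Proof. by apply/funext => x; rewrite /toC rmorphB. Qed.

Lemma real_part_sub f g : real_part f -> real_part g ->
  real_part (fun x => f x - g x).
Proof.
have [Ac AD AM] := real_part_algebra.
move=> Df Dg; rewrite (_ : (fun _ => _) = fun x => f x + -1 * g x).
  by apply: AD => //; exact: AM (Ac _) Dg.
by apply/funext => x; rewrite mulN1r.
Qed.

(** Each [J_n] is monotone, so that the limit form contracts: a smaller increment
    has a smaller energy. *)
Lemma energy_contraction (u f : E -> R) (r : R) : real_part u -> real_part f ->
  (forall z, `|delta u z| <= r * `|delta f z|) ->
  energy u u <= r ^+ 2 * energy f f.
Proof.
move=> Du Df uf.
have [_ Ju] := energy_core Du Du.
have [_ Jf] := energy_core Df Df.
have bdu := bm_delta (real_part_bm Du).
have bdf := bm_delta (real_part_bm Df).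
suff : 2 * energy u u <= r ^+ 2 * (2 * energy f f) by lra.
apply: (ler_cvg_to Ju (cvgMl_tmp (a := r ^+ 2) Jf)).
apply: nearW => n /=.
rewrite -scaled_meanZ; last exact: bmM.
apply: le_scaled_mean => //; first exact: bmM.
  by apply: bmM (bm_cst _) _; exact: bmM.
move=> z; rewrite -!expr2 -exprMn -[leLHS]real_normK ?num_real//.
rewrite -[leRHS]real_normK ?num_real// lerXn2r ?nnegrE// normrM.
by rewrite (le_trans (uf z))// ler_wpM2r// ler_norm.
Qed.

Lemma modcR (r : R) : modc r%:C = `|r|.
Proof. by rewrite /modc normcR. Qed.

Lemma nu_int_le_sqr (u : E -> R) (r : R) : bounded_measurable u ->
  (forall x, `|u x| <= r) -> \int[nu]_x (modc (toC u x) ^+ 2) <= r ^+ 2.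
Proof.
move=> bu ur.
rewrite (_ : r ^+ 2 = \int[nu]_x (r ^+ 2)); last first.
  by rewrite Rintegral_cst// [X in fine X]probability_setT mulr1.
have -> : (fun x => modc (toC u x) ^+ 2) = (fun x => u x ^+ 2).
  by apply/funext => x; rewrite modcR real_normK ?num_real.
apply: le_Rintegral => //.
- by apply: bm_integrable nu_fin _; exact: bmX.
- by apply: bm_integrable nu_fin _; exact: bm_cst.
move=> x _; rewrite -[leLHS]real_normK ?num_real// lerXn2r ?nnegrE//.
exact: le_trans (ur x).
Qed.

(** By the contraction property, closeness of the increments relative to those
    of a fixed [f] makes [gk] a Cauchy sequence for the norm of the form. Its
    limit in the domain coincides with [g] almost everywhere. *)
Lemma core_approx (f g : E -> R) (gk : nat -> E -> R) :
  real_part f -> (forall k, real_part (gk k)) ->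
  (forall k x, `|gk k x - g x| <= k.+1%:R^-1) ->
  (forall k z, `|delta (gk k) z - delta g z| <= k.+1%:R^-1 * `|delta f z|) ->
  real_dom g /\
  (fun k => energy (fun x => gk k x - g x) (fun x => gk k x - g x)) @ \oo --> (0 : R).
Proof.
move=> Df Dgk gkg dgkg.
pose r m n : R := m.+1%:R^-1 + n.+1%:R^-1.
have bg : bounded_measurable g.
  apply: bm_uniform_closure => e e0.
  near \oo => k; exists (gk k); first exact: real_part_bm (Dgk k).
  move=> x; rewrite distrC (le_trans (gkg k x))//.
  near: k; apply: filterS (near_infty_natSinv_lt (PosNum e0)) => m; exact: ltW.
(* Both parts of the norm of gk m - gk n are at most r m n ^+ 2, up to the
   constant energy f f. *)
have step1 m n : energy (fun x => gk m x - gk n x) (fun x => gk m x - gk n x) <=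
    r m n ^+ 2 * energy f f.
  apply: energy_contraction => //; first exact: real_part_sub.
  move=> z; rewrite /r mulrDl.
  have -> : delta (fun x => gk m x - gk n x) z =
      (delta (gk m) z - delta g z) - (delta (gk n) z - delta g z).
    by rewrite /delta; ring.
  by rewrite (le_trans (ler_normB _ _))// lerD.
have step2 m n : \int[nu]_x (modc (toC (fun x => gk m x - gk n x) x) ^+ 2) <= r m n ^+ 2.
  apply: nu_int_le_sqr.
    by apply: real_part_bm; exact: real_part_sub.
  move=> x; rewrite (_ : _ - _ = (gk m x - g x) - (gk n x - g x)); last by ring.
  by rewrite (le_trans (ler_normB _ _))// lerD.
have q0 : 0 <= energy f f by apply: energy_ge0; exact: real_part_dom.
have [|h dh hlim] := form_complete form_closed (f_ := fun k => toC (gk k)) (fun k => real_part_dom (Dgk k)).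
  move=> e e0.
  have e' : 0 < e / (4 * (energy f f + 1)) by rewrite divr_gt0// mulr_gt0//; lra.
  have [N _ HN] := near_infty_natSinv_lt (PosNum e'); exists N => m n Nm Nn.
  rewrite /norm1sq -toC_sub conjf_toC -/(energy _ _).
  apply: (@le_lt_trans _ _ (r m n ^+ 2 * (energy f f + 1))).
    rewrite mulrDr mulr1; apply: lerD; first exact: step1.
    by have := step2 m n; rewrite toC_sub.
  have hm := HN _ Nm; have hn := HN _ Nn; rewrite /= in hm hn.
  have m0 : 0 <= m.+1%:R^-1 :> R by [].
  have n0 : 0 <= n.+1%:R^-1 :> R by [].
  have m1 : m.+1%:R^-1 <= 1 :> R by rewrite invf_le1// ler1n.
  have n1 : n.+1%:R^-1 <= 1 :> R by rewrite invf_le1// ler1n.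
  have Q0 : 0 < energy f f + 1 by lra.
  have Q4 : 0 < 4 * (energy f f + 1) by lra.
  move: hm hn m0 n0 m1 n1; rewrite /r !ltr_pdivlMr//.
  move: (m.+1%:R^-1) (n.+1%:R^-1) => a b ha hb a0 b0 a1 b1.
  have r2 : (a + b) ^+ 2 <= 2 * (a + b) by nra.
  have := ler_wpM2r (ltW Q0) r2; lra.
have form_pos k : 0 <= complex.Re (form (fun x => toC (gk k) x - h x)
    (conjf (fun x => toC (gk k) x - h x))).
  have := form_ge0 form_closed (dom_sub (real_part_dom (Dgk k)) dh).
  by rewrite lecE => /andP[].
have gL : LfunK K nu 2%:E (toC g) by exact: bm_LfunK one_le2 nu_fin bg.
have hL : LfunK K nu 2%:E h by exact: dom_L2 form_closed _ dh.
have gkL k : LfunK K nu 2%:E (toC (gk k)).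
  by apply: bm_LfunK one_le2 nu_fin _ => //; exact: real_part_bm.
(* The limits of gk in the form norm and in the uniform norm agree in L^2. *)
have gh0 : \int[nu]_x (modc (toC g x - h x) ^+ 2) = 0.
  apply/eqP; rewrite eq_le; apply/andP; split; last first.
    by apply: Rintegral_ge0 => x _; exact: sqr_ge0.
  have lim2 : (fun k => 2 * (k.+1%:R^-1 ^+ 2) +
      2 * norm1sq nu form (fun x => toC (gk k) x - h x)) @ \oo --> (2 * 0 ^+ 2 + 2 * 0 : R).
    have inv0 : (fun k => k.+1%:R^-1 : R) @ \oo --> (0 : R) by exact: cvg_harmonic.
    apply: cvgD; apply: cvgMl_tmp => //.
    by rewrite expr2; apply: (cvgM inv0 inv0).
  rewrite (_ : 0 = 2 * 0 ^+ 2 + 2 * 0); last by ring.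
  apply: (ler_cvg_to (cvg_cst _) lim2); apply: nearW => k.
  have ig1 := integrable_modc_sqr (gkL k) gL.
  have ig2 := integrable_modc_sqr (gkL k) hL.
  have ig3 := integrable_modc_sqr gL hL.
  apply: (@le_trans _ _ (2 * \int[nu]_x (modc (toC (gk k) x - toC g x) ^+ 2) +
      2 * \int[nu]_x (modc (toC (gk k) x - h x) ^+ 2))).
    rewrite -!RintegralZl// -RintegralD//; last 2 first.
      exact: integrable_realZ.
      exact: integrable_realZ.
    apply: le_Rintegral => //.
      by apply: integrable_realD; exact: integrable_realZ.
    by move=> x _; exact: modc_sqr_sub_le.
  apply: lerD; rewrite ler_wpM2l//.
    rewrite (_ : (fun x => modc (toC (gk k) x - toC g x) ^+ 2) =
                 (fun x => modc (toC (fun x => gk k x - g x) x) ^+ 2)).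
      by apply: nu_int_le_sqr => //; apply: bmB => //; exact: real_part_bm.
    by apply/funext => x; rewrite toC_sub.
  by rewrite /norm1sq lerDr.
have gh : {ae nu, forall x, toC g x = h x} by exact: modc_sqr_int0_ae gL hL gh0.
have dg : real_dom g.
  apply: (dom_ae form_closed dh gL).
  by apply: filterS gh => x ->.
split => //.
apply: cvg0_approx.
  move=> k; apply: energy_ge0; rewrite /real_dom /= toC_sub.
  by apply: dom_sub => //; exact: real_part_dom.
move=> e e0; exists (fun k => norm1sq nu form (fun x => toC (gk k) x - h x)), 0.
split => //; first exact: ltW.
move=> k.
have d1 := dom_sub (real_part_dom (Dgk k)) dg.
have d2 := dom_sub (real_part_dom (Dgk k)) dh.
rewrite /energy toC_sub /norm1sq.
have ae1 : {ae nu, forall x, (toC (gk k) x - toC g x) = (toC (gk k) x - h x)}.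
  by apply: filterS gh => x ->.
have ae2 : {ae nu, forall x, (toC (gk k) x - toC g x) =
    conjf (fun x => toC (gk k) x - h x) x}.
  by apply: filterS gh => x gx; rewrite /conjf -gx /toC -rmorphB /= oppr0.
rewrite (form_ae form_closed d1 d2 d1 ae1).
rewrite (form_sym form_closed d2 d1).
rewrite (form_ae form_closed d1 (dom_conj form_closed d2) d2 ae2).
rewrite (form_sym form_closed (dom_conj form_closed d2) d2).
by rewrite lerDl; apply: Rintegral_ge0 => x _; exact: sqr_ge0.
Unshelve. all: by end_near.
Qed.

Lemma energy_approx_cvg (u v : nat -> E -> R) g h :
  (forall k, real_dom (u k)) -> (forall k, real_dom (v k)) ->
  real_dom g -> real_dom h ->
  (fun k => energy (fun x => u k x - g x) (fun x => u k x - g x)) @ \oo --> (0 : R) ->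
  (fun k => energy (fun x => v k x - h x) (fun x => v k x - h x)) @ \oo --> (0 : R) ->
  (fun k => energy (u k) (v k)) @ \oo --> energy g h.
Proof.
move=> du dv dg dh u0 v0.
have sub f f' : real_dom f -> real_dom f' -> real_dom (fun x => f x - f' x).
  by move=> df df'; rewrite /real_dom /= toC_sub; exact: dom_sub.
have dug k := sub _ _ (du k) dg.
have dvh k := sub _ _ (dv k) dh.
have split k : energy (u k) (v k) = energy (fun x => u k x - g x) (fun x => v k x - h x)
    + energy (fun x => u k x - g x) h + energy (fun x => v k x - h x) g + energy g h.
  have splitl a b c : real_dom a -> real_dom b -> real_dom c ->
      energy a c = energy (fun x => a x - b x) c + energy b c.
    move=> da db dc; rewrite -[energy _ c in X in _ = X + _]mul1r -energy_linl//.
      by congr energy; apply/funext => x; ring.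
    exact: sub.
  rewrite (splitl _ g)// (energy_sym (dug k) (dv k)) (energy_sym dg (dv k)).
  rewrite (splitl (v k) h (fun x => u k x - g x))// (splitl (v k) h g)//.
  rewrite (energy_sym (dvh k) (dug k)) (energy_sym dh (dug k)) (energy_sym dh dg).
  ring.
rewrite (_ : (fun k => _) = fun k => energy (fun x => u k x - g x) (fun x => v k x - h x)
    + energy (fun x => u k x - g x) h + energy (fun x => v k x - h x) g + energy g h);
  last by apply/funext => k; exact: split.
rewrite -[X in _ --> X]add0r -[X in _ --> X + _]addr0 -[X in _ --> X + _ + _]addr0.
apply: cvgD; last exact: cvg_cst.
apply: cvgD; last exact: energy_cvg0.
apply: cvgD; last exact: energy_cvg0.
suff : (fun k => `|energy (fun x => u k x - g x) (fun x => v k x - h x)|) @ \oo --> (0 : R).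
  move=> /cvgr0Pnorm_le H; apply/cvgr0Pnorm_le => e e0.
  by have := H e e0; apply: filterS => k; rewrite normr_id.
apply: cvg0_approx => // e e0.
exists (fun k => (energy (fun x => u k x - g x) (fun x => u k x - g x) / 1 +
  1 * energy (fun x => v k x - h x) (fun x => v k x - h x)) / 2), ((0 / 1 + 1 * 0) / 2).
split; last by move=> k; exact: energy_young.
- apply: cvgMr_tmp; apply: cvgD; first exact: cvgMr_tmp.
  exact: cvgMl_tmp.
- by rewrite mul0r mulr0 addr0 mul0r ltW.
Qed.

(** The error made on [J_n (delta g * delta h)] by replacing [g] and [h] with
    [gk k] and [hk k] is uniform in [n], because it is a multiple of
    [J_n ((delta f)^2)], which is bounded. *)
Lemma energy_limit_closure (f g h : E -> R) (gk hk : nat -> E -> R) (L : R) :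
  real_part f -> (forall k, real_part (gk k)) -> (forall k, real_part (hk k)) ->
  bounded_measurable g -> bounded_measurable h ->
  (forall k x, `|gk k x - g x| <= k.+1%:R^-1) ->
  (forall k z, `|delta (gk k) z - delta g z| <= k.+1%:R^-1 * `|delta f z|) ->
  (forall k x, `|hk k x - h x| <= k.+1%:R^-1) ->
  (forall k z, `|delta (hk k) z - delta h z| <= k.+1%:R^-1 * `|delta f z|) ->
  (forall z, `|delta g z| <= L * `|delta f z|) ->
  (forall z, `|delta h z| <= L * `|delta f z|) ->
  (fun n => J n (fun z => delta g z * delta h z)) @ \oo --> 2 * energy g h.
Proof.
move=> Df Dgk Dhk bg bh gkg dgk hkh dhk gL hL.
have [dg gk0] := core_approx Df Dgk gkg dgk.
have [dh hk0] := core_approx Df Dhk hkh dhk.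
have ghk := energy_approx_cvg (fun k => real_part_dom (Dgk k))
  (fun k => real_part_dom (Dhk k)) dg dh gk0 hk0.
have [_ Jf] := energy_core Df Df.
have q0 : 0 <= energy f f by apply: energy_ge0; exact: real_part_dom.
apply: cvg_by_approximation => e e0.
pose c := (2 * `|L| + 1) * (2 * energy f f + 1).
have c0 : 0 < c by rewrite mulr_gt0//; have := normr_ge0 L; lra.
have ec : 0 < e / c by rewrite divr_gt0.
have e2 : 0 < e / 2 by lra.
near \oo => k.
exists (fun n => J n (fun z => delta (gk k) z * delta (hk k) z)), (2 * energy (gk k) (hk k)).
split.
- by have [] := energy_core (Dgk k) (Dhk k).
- rewrite -mulrBr normrM ger0_norm//.
  have : `|energy (gk k) (hk k) - energy g h| <= e / 2.
    by near: k; move/cvgrPdist_le : ghk => /(_ _ e2); apply: filterS => k; rewrite distrC.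
  lra.
have bf := bm_delta (real_part_bm Df).
have kc : k.+1%:R^-1 <= e / c.
  by near: k; apply: filterS (near_infty_natSinv_lt (PosNum ec)) => m; exact: ltW.
have : \forall n \near \oo, J n (fun z => delta f z * delta f z) <= 2 * energy f f + 1.
  move/cvgrPdist_le : Jf => /(_ _ ltr01); apply: filterS => n.
  by rewrite ler_norml; lra.
apply: filterS => n Jn.
have bdg := bm_delta bg; have bdh := bm_delta bh.
have bdgk := bm_delta (real_part_bm (Dgk k)); have bdhk := bm_delta (real_part_bm (Dhk k)).
rewrite -scaled_meanB; [|exact: bmM|exact: bmM].
pose r : R := k.+1%:R^-1.
have r0 : 0 <= r by rewrite /r.
have r1 : r <= 1 by rewrite /r invf_le1// ler1n.
apply: (@le_trans _ _ (J n (fun z => r * (2 * `|L| + 1) * (delta f z * delta f z)))).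
  apply: norm_scaled_mean_le => //.
  - by apply: bmB; exact: bmM.
  - by apply: bmM (bm_cst _) _; exact: bmM.
  move=> z.
  have -> : delta g z * delta h z - delta (gk k) z * delta (hk k) z =
     - ((delta (gk k) z - delta g z) * delta h z + delta g z * (delta (hk k) z - delta h z)
     + (delta (gk k) z - delta g z) * (delta (hk k) z - delta h z)) by ring.
  have -> : delta f z * delta f z = `|delta f z| * `|delta f z|.
    by rewrite -expr2 -[LHS]real_normK ?num_real.
  rewrite normrN.
  move: (dgk k z) (dhk k z) (gL z) (hL z); rewrite -/r.
  move: (delta (gk k) z - delta g z) (delta (hk k) z - delta h z) => a b.
  move: (delta g z) (delta h z) (normr_ge0 (delta f z)) => g' h'.
  move: `|delta f z| => t t0 ha hb hg hh.
  have hg' : `|g'| <= `|L| * t by apply: (le_trans hg); rewrite ler_wpM2r// ler_norm.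
  have hh' : `|h'| <= `|L| * t by apply: (le_trans hh); rewrite ler_wpM2r// ler_norm.
  apply: (@le_trans _ _ (`|a| * `|h'| + `|g'| * `|b| + `|a| * `|b|)).
    by rewrite -!normrM (le_trans (ler_normD _ _))// lerD// ler_normD.
  have A1 : `|a| * `|h'| <= (r * t) * (`|L| * t) by apply: ler_pM.
  have A2 : `|g'| * `|b| <= (`|L| * t) * (r * t) by apply: ler_pM.
  have A3 : `|a| * `|b| <= (r * t) * (1 * t).
    by apply: ler_pM => //; apply: (le_trans hb); rewrite ler_wpM2r.
  by lra.
rewrite scaled_meanZ; last exact: bmM.
apply: (@le_trans _ _ (r * (2 * `|L| + 1) * (2 * energy f f + 1))).
  by rewrite ler_wpM2l// mulr_ge0//; have := normr_ge0 L; lra.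
by rewrite -mulrA -/c -ler_pdivlMr.
Unshelve. all: by end_near.
Qed.

(** A C^1 function of [f] is approximated by polynomials of [f], whose
    increments converge relative to those of [f]. *)
Lemma C1_calculus (f : E -> R) (G H dG dH : R -> R) : real_part f ->
  (forall x : R, is_derive x 1 G (dG x)) -> continuous dG ->
  (forall x : R, is_derive x 1 H (dH x)) -> continuous dH ->
  (fun n => J n (fun z => delta (G \o f) z * delta (H \o f) z)) @ \oo -->
    2 * energy (G \o f) (H \o f).
Proof.
move=> Df GD cG HD cH.
have [_ [M fM]] := real_part_bm Df.
have approx (Q dQ : R -> R) : (forall x : R, is_derive x 1 Q (dQ x)) -> continuous dQ ->
    exists gk : nat -> E -> R, exists L : R,
    [/\ forall k, real_part (gk k),
        forall k x, `|gk k x - (Q \o f) x| <= k.+1%:R^-1,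
        forall k z, `|delta (gk k) z - delta (Q \o f) z| <= k.+1%:R^-1 * `|delta f z|
      & forall z, `|delta (Q \o f) z| <= L * `|delta f z|].
  move=> QD cQ.
  have /choice[q hq] : forall k : nat, exists q : {poly R},
      forall x y, `|x| <= M -> `|y| <= M -> `|q.[x] - Q x| <= k.+1%:R^-1 /\
      `|(q.[x] - Q x) - (q.[y] - Q y)| <= k.+1%:R^-1 * `|x - y|.
    by move=> k; apply: (poly_C1_approx M QD cQ); rewrite invr_gt0.
  have [L hL] : exists L : R, forall x, `|x| <= M -> `|dQ x| <= L.
    have /compact_bounded[L [_ hL]] : compact (dQ @` `[- M, M]%classic).
      by apply: continuous_compact; [exact: continuous_subspaceT|exact: segment_compact].
    exists (L + 1) => x xM; apply: (hL (L + 1)); first by lra.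
    by exists x => //=; rewrite in_itv/= -ler_norml.
  exists (fun k x => (q k).[f x]), L; split.
  - by move=> k; exact: horner_mem real_part_algebra Df.
  - by move=> k x; have [] := hq k _ _ (fM x) (fM x).
  - move=> k z; have [_] := hq k _ _ (fM z.1) (fM z.2).
    by rewrite /delta /=; congr (`| _ | <= _); ring.
  - by move=> z; apply: (derivative_bounded_lipschitz QD hL).
have [gk [L1 [D1 a1 b1 l1]]] := approx G dG GD cG.
have [hk [L2 [D2 a2 b2 l2]]] := approx H dH HD cH.
have bmc gk' Q : (forall k, real_part (gk' k)) ->
    (forall k x, `|gk' k x - (Q \o f) x| <= k.+1%:R^-1) -> bounded_measurable (Q \o f).
  move=> D' a'; apply: bm_uniform_closure => e e0.
  near \oo => k; exists (gk' k); first exact: real_part_bm (D' k).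
  move=> x; rewrite distrC (le_trans (a' k x))//.
  near: k; apply: filterS (near_infty_natSinv_lt (PosNum e0)) => m; exact: ltW.
apply: (@energy_limit_closure f _ _ gk hk (Num.max L1 L2)) => //.
- exact: bmc D1 a1.
- exact: bmc D2 a2.
- by move=> z; rewrite (le_trans (l1 z))// ler_wpM2r// le_max lexx.
- by move=> z; rewrite (le_trans (l2 z))// ler_wpM2r// le_max lexx orbT.
Unshelve. all: by end_near.
Qed.

(** * Consequences of locality *)
Context (form_local : local_form dom form).

(** Subtracting [B 0] from a bump [B] leaves the increments unchanged, so that
    locality applies to the limit given by the C^1 calculus. *)
Lemma disjoint_bumps_cvg0 (f : E -> R) (I1 I2 : R * R) : real_part f -> I1.2 < I2.1 ->
  (fun n => J n (fun z => delta (smooth_bump I1.1 I1.2 \o f) z *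
                          delta (smooth_bump I2.1 I2.2 \o f) z)) @ \oo --> (0 : R).
Proof.
case: I1 I2 => a1 b1 [a2 b2] /= Df b1a2.
pose B1 := smooth_bump a1 b1; pose B2 := smooth_bump a2 b2.
have [dB1 cB1 DB1] := bump_C1 a1 b1.
have [dB2 cB2 DB2] := bump_C1 a2 b2.
have shift (B dB : R -> R) : (forall x : R, is_derive x 1 B (dB x)) ->
    forall x : R, is_derive x 1 (fun y => B y - B 0) (dB x).
  move=> BD x; rewrite -[dB x]subr0.
  exact: (is_deriveB (BD x) (is_derive_cst (B 0) x 1)).
have := C1_calculus Df (shift _ _ DB1) cB1 (shift _ _ DB2) cB2.
have -> : energy ((fun y => B1 y - B1 0) \o f) ((fun y => B2 y - B2 0) \o f) = 0.
  rewrite /energy (form_local (real_part_dom Df) (bump_Cc_infty a1 b1) (bump_Cc_infty a2 b2))//.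
  apply/seteqP; split => // x [/(@bump_supp _ _ _ _) + /(@bump_supp _ _ _ _)].
  by rewrite /= !in_itv/=; lra.
rewrite mulr0 (_ : (fun n => _) = fun n => J n (fun z => delta (B1 \o f) z * delta (B2 \o f) z))//.
apply/funext => n; congr scaled_mean; apply/funext => z.
by rewrite /delta /B1 /B2 /=; ring.
Qed.

(** Locality makes the jumps of [f] above a given size negligible for [J_n], and
    the smaller ones contribute at most [s] times the bounded second moments. *)
Lemma fourth_moment_cvg0 (f : E -> R) : real_part f ->
  (fun n => J n (fun z => delta f z ^+ 4)) @ \oo --> (0 : R).
Proof.
move=> Df.
have bf := real_part_bm Df.
have bdf := bm_delta bf.
have [_ [M0 fM0]] := bf.
pose M := `|M0| + 1.
have M_gt0 : 0 < M by rewrite ltr_wpDl.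
have fM x : `|f x| <= M by rewrite (le_trans (fM0 x))// (le_trans (ler_norm _))// lerDl.
have [_ Jf] := energy_core Df Df.
have q0 : 0 <= energy f f by apply: energy_ge0; exact: real_part_dom.
apply: cvg0_approx.
  move=> n; rewrite mulr_ge0 ?(ltW (alpha_gt0 n))//; apply: Rintegral_ge0 => w _.
  by rewrite exprn_even_ge0.
move=> e e0.
have c0 : 0 < 2 * energy f f + 1 by lra.
pose s := e / (2 * energy f f + 1).
have s0 : 0 < s by rewrite divr_gt0.
have [C [N [I [C0 Idisj Ile]]]] := fourth_power_le_bumps M_gt0 s0.
pose B k := smooth_bump (I k).1 (I k).2.
have bB k : bounded_measurable (B k \o f).
  have [dB cB DB] := bump_C1 (I k).1 (I k).2.
  apply: bm_uniform_closure => r r0.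
  have [q hq] := poly_C1_approx M DB cB r0.
  exists (fun x => q.[f x]); first exact: real_part_bm (horner_mem q real_part_algebra Df).
  by move=> x; rewrite distrC; have [] := hq _ _ (fM x) (fM x).
have bdB k := bm_delta (bB k).
pose pair (k l : nat) z := delta (B k \o f) z * delta (B l \o f) z.
have bpair k l : bounded_measurable (pair k l) by exact: bmM.
exists (fun n => s * J n (fun z => delta f z * delta f z) +
  - C * \sum_(k < N) \sum_(l < N | (k + 4 <= l)%N) J n (pair k l)), (s * (2 * energy f f) + - C * 0).
split.
- apply: cvgD; first exact: cvgMl_tmp.
  apply: cvgMl_tmp.
  have := @cvg_finite_sum R _ (index_enum 'I_N) predT
    (fun k n => \sum_(l < N | (k + 4 <= l)%N) J n (pair k l)) (fun=> 0).
  rewrite big1//; apply => k _.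
  have := @cvg_finite_sum R _ (index_enum 'I_N) (fun l : 'I_N => (k + 4 <= l)%N)
    (fun l n => J n (pair k l)) (fun=> 0).
  rewrite big1//; apply => l kl.
  exact: disjoint_bumps_cvg0 Df (Idisj _ _ kl).
- rewrite mulr0 addr0 /s mulrAC ler_pdivrMr// ler_wpM2l ?(ltW e0)//; lra.
move=> n.
under eq_bigr do rewrite -scaled_mean_sum//.
rewrite -scaled_mean_sum; last by move=> k; exact: bm_sum.
rewrite -scaled_meanZ; last exact: bmM.
rewrite -scaled_meanZ; last by apply: bm_sum => k; exact: bm_sum.
have b1 : bounded_measurable (fun z => s * (delta f z * delta f z)).
  by apply: bmM (bm_cst _) _; exact: bmM.
have b2 : bounded_measurable (fun z => - C * \sum_(k < N) \sum_(l < N | (k + 4 <= l)%N) pair k l z).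
  by apply: bmM (bm_cst _) _; apply: bm_sum => k; exact: bm_sum.
rewrite -scaled_meanD//; apply: le_scaled_mean => //; first exact: bmX.
  exact: bmD.
move=> z; rewrite {1}/delta.
apply: le_trans (Ile _ _ (fM z.1) (fM z.2)) _.
rewrite mulNr -mulrN -sumrN expr2 lerD2l ler_wpM2l//.
apply: ler_sum => k _; rewrite -sumrN; apply: ler_sum => l kl.
(* As the supports are disjoint, the products at a single point vanish and
   only the jump terms remain in - pair k l. *)
have disj t : B k t * B l t = 0.
  have [tk|tk] := leP t (I k).2; last by rewrite /B bump_eq0 ?mul0r//; apply/negP; lra.
  have := Idisj _ _ kl => kl'.
  by rewrite [B l t]bump_eq0 ?mulr0//; apply/negP; lra.
have := disj (f z.1); have := disj (f z.2).
by rewrite /pair /delta /= -/(B k) -/(B l); lra.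
Qed.

(** * The square field operator as a limit *)
Context (Gam : (E -> R[i]) -> (E -> R[i]) -> E -> R[i]).
Context (Gam_def : square_field_operator K nu dom form Gam).

Definition realGam (f g : E -> R) (x : E) : R := complex.Re (Gam (toC f) (toC g) x).
Definition imGam (f g : E -> R) (x : E) : R := complex.Im (Gam (toC f) (toC g) x).

Lemma realGam_integrable f g : real_part f -> real_part g ->
  nu.-integrable setT (EFin \o realGam f g).
Proof.
move=> Df Dg; apply/Lfun1_integrable.
by have [] := sqf_L1 Gam_def (real_part_dom Df) (real_part_dom Dg).
Qed.

Lemma imGam_integrable f g : real_part f -> real_part g ->
  nu.-integrable setT (EFin \o imGam f g).
Proof.
move=> Df Dg; apply/Lfun1_integrable.
by have [] := sqf_L1 Gam_def (real_part_dom Df) (real_part_dom Dg).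
Qed.

Lemma real_part_mul f g : real_part f -> real_part g -> real_part (fun x => f x * g x).
Proof. by move=> Df Dg; have [_ _] := real_part_algebra; apply. Qed.

Lemma toC_mul (f g : E -> R) : (fun x => toC f x * toC g x) = toC (fun x => f x * g x).
Proof. by apply/funext => x; rewrite /toC rmorphM. Qed.

(** The increments satisfy the algebraic identity
    [delta (fh) delta g + delta (gh) delta f - delta h delta (fg)
     = delta f delta g (h(x) + h(y))],
    whose left side is the one that defines Gamma. *)
Lemma carre_du_champ_midpoint f g h : real_part f -> real_part g -> real_part h ->
  (fun n => J n (fun z => delta f z * delta g z * (h z.1 + h z.2))) @ \oo -->
    2 * \int[nu]_x (h x * realGam f g x) /\
  \int[nu]_x (h x * imGam f g x) = 0.
Proof.
move=> Df Dg Dh.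
have bounded u : real_part u -> LfunK K nu +oo%E (toC u).
  by move=> Du; apply: bm_LfunK nu_fin (real_part_bm Du) => //; exact: leey.
have := sqf_id Gam_def (real_part_dom Df) (bounded _ Df) (real_part_dom Dg) (bounded _ Dg)
  (real_part_dom Dh) (bounded _ Dh).
have Dfh := real_part_mul Df Dh; have Dgh := real_part_mul Dg Dh.
have Dfg := real_part_mul Df Dg.
rewrite !toC_mul.
have [-> J1] := energy_core Dfh Dg.
have [-> J2] := energy_core Dgh Df.
have [-> J3] := energy_core Dh Dfg.
set e1 := energy _ _ in J1 *; set e2 := energy _ _ in J2 *; set e3 := energy _ _ in J3 *.
rewrite /cint => -[eRe eIm].
have -> : \int[nu]_x (h x * realGam f g x) = e1 + e2 - e3.
  rewrite eRe; apply: eq_Rintegral => x _; rewrite /toC /realGam.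
  by case: (Gam _ _ _) => r i /=; rewrite mul0r subr0.
split; last first.
  rewrite (_ : 0 = 0 + 0 - 0 :> R); last by ring.
  rewrite eIm; apply: eq_Rintegral => x _; rewrite /toC /imGam.
  by case: (Gam _ _ _) => r i /=; rewrite mul0r addr0.
have bd u : real_part u -> bounded_measurable (delta u).
  by move=> Du; exact/bm_delta/real_part_bm.
have -> : (fun n => J n (fun z => delta f z * delta g z * (h z.1 + h z.2))) = (fun n =>
   J n (fun z => delta (fun x => f x * h x) z * delta g z) +
   J n (fun z => delta (fun x => g x * h x) z * delta f z) -
   J n (fun z => delta h z * delta (fun x => f x * g x) z)).
  apply/funext => n.
  rewrite -scaled_meanD; [|by apply: bmM; exact: bd..].
  rewrite -scaled_meanB; [|by apply: bmD; apply: bmM; exact: bd|by apply: bmM; exact: bd].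
  by congr scaled_mean; apply/funext => z; rewrite /delta; ring.
rewrite (_ : 2 * _ = 2 * e1 + 2 * e2 - 2 * e3); last by ring.
by apply: cvgB => //; exact: cvgD.
Qed.

(** Freezing [h] at [Y] costs the product of three increments, which is at most
    [s (delta f)^2 + ((delta g)^4 + (delta h)^4) / s]. *)
Lemma carre_du_champ f g h : real_part f -> real_part g -> real_part h ->
  (fun n => J n (fun z => h z.2 * (delta f z * delta g z))) @ \oo -->
    \int[nu]_x (h x * realGam f g x).
Proof.
move=> Df Dg Dh.
have [mid _] := carre_du_champ_midpoint Df Dg Dh.
have bd u : real_part u -> bounded_measurable (delta u).
  by move=> Du; exact/bm_delta/real_part_bm.
have bdf := bd _ Df; have bdg := bd _ Dg; have bdh := bd _ Dh.
have bfg := bmM bdf bdg.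
have bh1 := bm_fst (real_part_bm Dh); have bh2 := bm_snd (real_part_bm Dh).
have rest0 : (fun n => J n (fun z => delta f z * delta g z * delta h z)) @ \oo --> (0 : R).
  have [_ Jf] := energy_core Df Df.
  have q0 : 0 <= energy f f by apply: energy_ge0; exact: real_part_dom.
  suff : (fun n => `|J n (fun z => delta f z * delta g z * delta h z)|) @ \oo --> (0 : R).
    move=> /cvgr0Pnorm_le H; apply/cvgr0Pnorm_le => e e0.
    by have := H e e0; apply: filterS => k; rewrite normr_id.
  apply: cvg0_approx => // e e0.
  have c0 : 0 < 2 * energy f f + 1 by lra.
  pose s := e / (2 * energy f f + 1).
  have s0 : 0 < s by rewrite divr_gt0.
  exists (fun n => s * J n (fun z => delta f z * delta f z) +
    s^-1 * (J n (fun z => delta g z ^+ 4) + J n (fun z => delta h z ^+ 4))),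
    (s * (2 * energy f f) + s^-1 * (0 + 0)); split.
  - apply: cvgD; apply: cvgMl_tmp => //.
    by apply: cvgD; exact: fourth_moment_cvg0.
  - rewrite addr0 mulr0 addr0 /s mulrAC ler_pdivrMr// ler_wpM2l ?(ltW e0)//; lra.
  move=> n.
  rewrite -scaled_meanD; [|exact: bmX|exact: bmX].
  rewrite -scaled_meanZ; last exact: bmM.
  rewrite -scaled_meanZ; last by apply: bmD; exact: bmX.
  rewrite -scaled_meanD; [|by apply: bmM (bm_cst _) _; exact: bmM|
    by apply: bmM (bm_cst _) _; apply: bmD; exact: bmX].
  apply: norm_scaled_mean_le => //; first exact: bmM.
    apply: bmD; apply: bmM (bm_cst _) _; first exact: bmM.
    by apply: bmD; exact: bmX.
  move=> z; move: (delta f z) (delta g z) (delta h z) => a b c.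
  have sV : s * s^-1 = 1 by rewrite divff// gt_eqF.
  have sV0 : 0 < s^-1 by rewrite invr_gt0.
  have Y1 : `|a * b * c| <= s * (a * a) + s^-1 * (b * c) ^+ 2.
    have P1 : 0 <= (s * a + b * c) ^+ 2 / s by rewrite divr_ge0 ?sqr_ge0// ltW.
    have P2 : 0 <= (s * a - b * c) ^+ 2 / s by rewrite divr_ge0 ?sqr_ge0// ltW.
    have E1 : (s * a + b * c) ^+ 2 / s = s * (a * a) + 2 * (a * b * c) + s^-1 * (b * c) ^+ 2.
      by field; rewrite gt_eqF.
    have E2 : (s * a - b * c) ^+ 2 / s = s * (a * a) - 2 * (a * b * c) + s^-1 * (b * c) ^+ 2.
      by field; rewrite gt_eqF.
    have T1 : 0 <= s * (a * a) by rewrite mulr_ge0 ?(ltW s0)// -expr2 sqr_ge0.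
    have T2 : 0 <= s^-1 * (b * c) ^+ 2 by rewrite mulr_ge0 ?(ltW sV0)// sqr_ge0.
    by rewrite ler_norml; lra.
  apply: (le_trans Y1); rewrite lerD2l ler_wpM2l ?(ltW sV0)//.
  by have := sqr_ge0 (b ^+ 2 - c ^+ 2); have := sqr_ge0 (b ^+ 2); have := sqr_ge0 (c ^+ 2); nra.
have -> : (fun n => J n (fun z => h z.2 * (delta f z * delta g z))) = (fun n =>
    2^-1 * (J n (fun z => delta f z * delta g z * (h z.1 + h z.2)) -
    J n (fun z => delta f z * delta g z * delta h z))).
  apply/funext => n; rewrite -scaled_meanB; [|by apply: bmM => //; exact: bmD|exact: bmM].
  rewrite -scaled_meanZ; last by apply: bmB; apply: bmM => //; exact: bmD.
  by congr scaled_mean; apply/funext => z;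
    rewrite -[delta h z]/(h z.1 - h z.2); field.
rewrite (_ : \int[nu]_x _ = 2^-1 * (2 * (\int[nu]_x (h x * realGam f g x)) - 0)); last by field.
by apply: cvgMl_tmp; exact: cvgB.
Qed.

Lemma Rintegral_mul_dist (u h gam : E -> R) (r : R) :
  bounded_measurable u -> bounded_measurable h -> nu.-integrable setT (EFin \o gam) ->
  (forall x, `|u x - h x| <= r) ->
  `|\int[nu]_x (u x * gam x) - \int[nu]_x (h x * gam x)| <= r * \int[nu]_x `|gam x|.
Proof.
move=> bu bh ig uh.
rewrite -RintegralB//; [|exact: integrable_bmM..].
rewrite -RintegralZl//; last exact: integrable_norm.
have ign : nu.-integrable setT (EFin \o (fun x => (u x - h x) * gam x)).
  by apply: integrable_bmM => //; exact: bmB.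
have -> : (fun x => u x * gam x - h x * gam x) = (fun x => (u x - h x) * gam x).
  by apply/funext => x; rewrite mulrBl.
apply: (le_trans (le_normr_Rintegral measurableT ign)).
apply: le_Rintegral => //; first exact: integrable_norm.
  by apply: integrable_realZ; exact: integrable_norm.
by move=> x _; rewrite normrM ler_wpM2r.
Qed.

(** Both sides are continuous in [u] for the uniform norm, uniformly in [n]:
    the left one because [J_n] of [|delta f * delta g|] is bounded, the right
    one because Gamma is integrable. *)
Lemma carre_du_champ_closure f g u : real_part f -> real_part g ->
  uniform_closure real_part u ->
  (fun n => J n (fun z => u z.2 * (delta f z * delta g z))) @ \oo -->
    \int[nu]_x (u x * realGam f g x) /\
  \int[nu]_x (u x * imGam f g x) = 0.
Proof.
move=> Df Dg cu.
have bu : bounded_measurable u.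
  apply: bm_uniform_closure => e e0; have [h Dh uh] := cu e e0.
  by exists h => //; exact: real_part_bm.
have iRe := realGam_integrable Df Dg; have iIm := imGam_integrable Df Dg.
have bdf := bm_delta (real_part_bm Df); have bdg := bm_delta (real_part_bm Dg).
have bfg := bmM bdf bdg.
split; last first.
  apply/eqP; rewrite -normr_le0; apply/ler_addgt0Pr => e e0; rewrite add0r.
  have n0 : 0 <= \int[nu]_x `|imGam f g x| by exact: Rintegral_ge0.
  have c0 : 0 < \int[nu]_x `|imGam f g x| + 1 by lra.
  have [h Dh uh] := cu _ (divr_gt0 e0 c0).
  have := Rintegral_mul_dist bu (real_part_bm Dh) iIm uh.
  have [_ ->] := carre_du_champ_midpoint Df Dg Dh.
  rewrite subr0 => /le_trans; apply.
  by rewrite mulrAC ler_pdivrMr// ler_wpM2l ?(ltW e0)// lerDl.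
apply: cvg_by_approximation => e e0.
have [_ Jf] := energy_core Df Df; have [_ Jg] := energy_core Dg Dg.
have qf : 0 <= energy f f by apply: energy_ge0; exact: real_part_dom.
have qg : 0 <= energy g g by apply: energy_ge0; exact: real_part_dom.
have dist h r := @Rintegral_mul_dist u h (realGam f g) r bu ^~ iRe.
have : 0 <= \int[nu]_x `|realGam f g x| by exact: Rintegral_ge0.
move: (\int[nu]_x `|realGam f g x|) dist => I0 dist n0.
pose c := I0 + 2 * energy f f + 2 * energy g g + 2.
have c0 : 0 < c by rewrite /c; lra.
have ec0 := divr_gt0 e0 c0.
have ecc : e / c * c = e by rewrite divfK// gt_eqF.
have [h Dh uh] := cu _ ec0.
have bh := real_part_bm Dh.
exists (fun n => J n (fun z => h z.2 * (delta f z * delta g z))), (\int[nu]_x (h x * realGam f g x)).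
split; first exact: carre_du_champ.
  rewrite distrC (le_trans (dist _ _ bh uh))//.
  by rewrite -[leRHS]ecc ler_wpM2l ?(ltW ec0)// /c; lra.
have Jf1 : \forall n \near \oo, J n (fun z => delta f z * delta f z) <= 2 * energy f f + 1.
  move/cvgrPdist_le : Jf => /(_ _ ltr01); apply: filterS => n.
  by rewrite ler_norml; lra.
have Jg1 : \forall n \near \oo, J n (fun z => delta g z * delta g z) <= 2 * energy g g + 1.
  move/cvgrPdist_le : Jg => /(_ _ ltr01); apply: filterS => n.
  by rewrite ler_norml; lra.
near=> n.
have Jfn : J n (fun z => delta f z * delta f z) <= 2 * energy f f + 1 by near: n.
have Jgn : J n (fun z => delta g z * delta g z) <= 2 * energy g g + 1 by near: n.
have b2 (v : E -> R) : bounded_measurable v ->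
    bounded_measurable (fun z : E * E => v z.2 * (delta f z * delta g z)).
  by move=> bv; apply: bmM bfg; exact: bm_snd.
rewrite -scaled_meanB; [|exact: b2..].
apply: (@le_trans _ _ (J n (fun z => e / c * (delta f z * delta f z + delta g z * delta g z)))).
  apply: norm_scaled_mean_le => //.
  - by apply: bmB; exact: b2.
  - by apply: bmM (bm_cst _) _; apply: bmD; exact: bmM.
  move=> z; rewrite -mulrBl normrM; apply: ler_pM => //.
  move: (delta f z) (delta g z) => a b; rewrite ler_norml.
  by have := sqr_ge0 (a + b); have := sqr_ge0 (a - b); have := sqr_ge0 a; have := sqr_ge0 b; nra.
rewrite scaled_meanZ; last by apply: bmD; exact: bmM.
rewrite scaled_meanD; [|exact: bmM..].
rewrite -[leRHS]ecc ler_wpM2l ?(ltW ec0)//.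
by rewrite /c; lra.
Unshelve. all: by end_near.
Qed.

Lemma sqr_sum_le (p : nat) (x : 'I_p -> R) :
  (\sum_i x i) ^+ 2 <= p%:R * \sum_i x i ^+ 2.
Proof.
have -> : p%:R * \sum_i x i ^+ 2 = \sum_(i < p) \sum_(j < p) ((x i ^+ 2 + x j ^+ 2) / 2).
  transitivity (\sum_(i < p) (x i ^+ 2 * p%:R / 2 + (\sum_j x j ^+ 2) / 2)).
    rewrite big_split /= sumr_const card_ord -mulr_suml -mulr_suml -[X in _ + X]mulr_natl.
    by field.
  apply: eq_bigr => i _; rewrite -mulr_suml big_split/= sumr_const card_ord.
  by rewrite -[x i ^+ 2 *+ p]mulr_natr mulrDl.
rewrite expr2 mulr_suml; apply: ler_sum => i _.
rewrite mulr_sumr; apply: ler_sum => j _.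
by have := sqr_ge0 (x i - x j); nra.
Qed.

(** * The chain rule *)
Section ChainRule.
Context (p : nat) (f : 'I_p -> E -> R) (f_D : forall i, D (toC (f i))).
Context (F : 'rV[R]_p -> R) (F_C1 : C1 F).

Local Notation Ff := (fun x => F (\row_i f i x)).
Local Notation dF i := (fun x => partial F i (\row_k f k x)).

Definition linear_increment (z : E * E) : R := \sum_i dF i z.2 * delta (f i) z.

Lemma uniformly_bounded : exists M : R, forall i x, `|f i x| <= M.
Proof.
have /choice[M hM] : forall i, exists M : R, forall x, `|f i x| <= M.
  by move=> i; have [_] := real_part_bm (f_D i).
exists (\sum_i `|M i|) => i x; rewrite (le_trans (hM i x))//.
rewrite (le_trans (ler_norm _))// (bigD1 i)//= lerDl.
exact: sumr_ge0.
Qed.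

Lemma closure_comp (u : 'rV[R]_p -> R) : continuous u ->
  uniform_closure real_part (fun x => u (\row_i f i x)).
Proof.
have [M fM] := uniformly_bounded.
exact: (weierstrass real_part_algebra f_D fM).
Qed.

Lemma bm_comp (u : 'rV[R]_p -> R) : continuous u ->
  bounded_measurable (fun x => u (\row_i f i x)).
Proof.
move=> cu; apply: bm_uniform_closure => e e0; have [h Dh uh] := closure_comp cu e0.
by exists h => //; exact: real_part_bm.
Qed.

Lemma continuous_F : continuous F.
Proof. by case: F_C1 => dF _ x; exact: differentiable_continuous. Qed.

Lemma bm_Ff : bounded_measurable Ff.
Proof. exact: bm_comp continuous_F. Qed.

Lemma bm_dF i : bounded_measurable (dF i).
Proof. by case: F_C1 => _ cdF; exact: bm_comp. Qed.

Lemma bm_deltaf i : bounded_measurable (delta (f i)).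
Proof. by apply: bm_delta; exact: real_part_bm (f_D i). Qed.

Lemma bm_linear_increment : bounded_measurable linear_increment.
Proof.
by apply: bm_sum => i; exact: (bmM (bm_snd (bm_dF i)) (bm_deltaf i)).
Qed.

Lemma linear_increment_cvg :
  (fun n => J n (fun z => linear_increment z ^+ 2)) @ \oo -->
  \sum_i \sum_j \int[nu]_x (dF i x * dF j x * realGam (f i) (f j) x).
Proof.
have [_ cdF] := F_C1.
have cdd i j : continuous (fun v => partial F i v * partial F j v).
  by move=> v; apply: continuousM; exact: cdF.
have term i j := carre_du_champ_closure (f_D i) (f_D j) (closure_comp (cdd i j)).
pose k i j (z : E * E) := dF i z.2 * dF j z.2 * (delta (f i) z * delta (f j) z).
have bk i j : bounded_measurable (k i j).
  apply: (bmM _ (bmM (bm_deltaf i) (bm_deltaf j))).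
  exact: (bmM (bm_snd (bm_dF i)) (bm_snd (bm_dF j))).
have -> : (fun n => J n (fun z => linear_increment z ^+ 2)) =
    (fun n => \sum_i \sum_j J n (k i j)).
  apply/funext => n.
  under eq_bigr do rewrite -scaled_mean_sum//.
  rewrite -scaled_mean_sum; last by move=> i; exact: bm_sum.
  congr scaled_mean; apply/funext => z.
  rewrite /linear_increment expr2 mulr_suml; apply: eq_bigr => i _.
  by rewrite mulr_sumr; apply: eq_bigr => j _; rewrite /k; ring.
apply: cvg_finite_sum => i _; apply: cvg_finite_sum => j _.
by have [] := term i j.
Qed.

(** By the Taylor bound, the square of the remainder is at most
    [2 p s^2 |delta f|^2 + C' |delta f|^4], where [s] is arbitrarily small, the
    second moments are bounded and the fourth ones tend to 0. *)
Lemma remainder_cvg0 :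
  (fun n => J n (fun z => (delta Ff z - linear_increment z) ^+ 2)) @ \oo --> (0 : R).
Proof.
have [M fM] := uniformly_bounded.
have q0 i : 0 <= energy (f i) (f i) by apply: energy_ge0; exact: real_part_dom (f_D i).
pose Q := \sum_i 2 * energy (f i) (f i).
have Q0 : 0 <= Q by apply: sumr_ge0 => i _; rewrite mulr_ge0.
apply: cvg0_approx.
  move=> n; rewrite mulr_ge0 ?(ltW (alpha_gt0 n))//; apply: Rintegral_ge0 => w _.
  exact: sqr_ge0.
move=> e e0.
have c0 : 0 < 2 * p%:R * Q + 1 by rewrite ltr_wpDl// !mulr_ge0.
pose s := Num.sqrt (e / (2 * p%:R * Q + 1)).
have s0 : 0 < s by rewrite sqrtr_gt0 divr_gt0.
have s2 : s ^+ 2 = e / (2 * p%:R * Q + 1) by rewrite sqr_sqrtr// ltW// divr_gt0.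
have [C [C0 hC]] := taylor_remainder M F_C1 s0.
pose B := p%:R * (2 * M) ^+ 2.
pose C' := 2 * p%:R * C ^+ 2 * B * p%:R.
have B0 : 0 <= B by rewrite mulr_ge0// sqr_ge0.
have C'0 : 0 <= C'.
  apply: mulr_ge0 => //; apply: mulr_ge0 => //; apply: mulr_ge0; last exact: sqr_ge0.
  exact: mulr_ge0.
have bd2 i := bmM (bm_deltaf i) (bm_deltaf i).
have bd4 i := bmX 4 (bm_deltaf i).
exists (fun n => 2 * p%:R * s ^+ 2 * \sum_i J n (fun z => delta (f i) z * delta (f i) z) +
   C' * \sum_i J n (fun z => delta (f i) z ^+ 4)), (2 * p%:R * s ^+ 2 * Q + C' * \sum_(i < p) 0).
split.
- apply: cvgD; apply: cvgMl_tmp; apply: cvg_finite_sum => i _.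
    by have [] := energy_core (f_D i) (f_D i).
  exact: fourth_moment_cvg0 (f_D i).
- rewrite big1// mulr0 addr0 s2 mulrAC mulrA ler_pdivrMr//.
  rewrite mulrDr mulr1; rewrite (_ : 2 * p%:R * Q * e = e * (2 * p%:R * Q)).
    by rewrite lerDl ltW.
  by rewrite mulrC.
move=> n.
rewrite -!scaled_mean_sum//.
rewrite -!scaled_meanZ; [|exact: bm_sum..].
rewrite -scaled_meanD; [|by apply: bmM (bm_cst _) _; exact: bm_sum..].
apply: le_scaled_mean => //.
- by apply: bmX; apply: bmB; [exact: bm_delta bm_Ff|exact: bm_linear_increment].
- by apply: bmD; apply: bmM (bm_cst _) _; exact: bm_sum.
move=> z.
pose x : 'rV_p := \row_i f i z.2; pose y : 'rV_p := \row_i f i z.1.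
have xM j : `|x 0 j| <= M by rewrite mxE.
have yM j : `|y 0 j| <= M by rewrite mxE.
have dE i : y 0 i - x 0 i = delta (f i) z by rewrite !mxE.
have := hC x y xM yM.
have -> : \sum_i partial F i x * (y 0 i - x 0 i) = linear_increment z.
  by apply: eq_bigr => i _; rewrite dE.
have -> : \sum_j (y 0 j - x 0 j) ^+ 2 = \sum_j delta (f j) z ^+ 2.
  by apply: eq_bigr => i _; rewrite dE.
have -> : \sum_i `|y 0 i - x 0 i| = \sum_i `|delta (f i) z|.
  by apply: eq_bigr => i _; rewrite dE.
rewrite -[F y - F x]/(delta Ff z).
set S := \sum_j delta (f j) z ^+ 2; set A := \sum_i `|delta (f i) z|.
set Q4 := \sum_i delta (f i) z ^+ 4.
move: (delta Ff z - linear_increment z) => r hr.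
have S0 : 0 <= S by apply: sumr_ge0 => i _; exact: sqr_ge0.
have A0 : 0 <= A by apply: sumr_ge0.
have AS : A ^+ 2 <= p%:R * S.
  apply: (le_trans (sqr_sum_le _)); rewrite ler_wpM2l//; apply: ler_sum => i _.
  by rewrite real_normK ?num_real.
have SQ : S ^+ 2 <= p%:R * Q4.
  apply: (le_trans (sqr_sum_le _)); rewrite ler_wpM2l//; apply: ler_sum => i _.
  by rewrite -exprM.
(* A sixth power of the increments occurs; B, which bounds their squares, turns
   it into a fourth power. *)
have SB : S <= B.
  rewrite /B mulr_natl -[X in _ *+ X]card_ord -sumr_const; apply: ler_sum => i _.
  have := fM i z.1; have := fM i z.2; rewrite /delta !ler_norml => *.
  by rewrite -[leLHS]real_normK ?num_real// lerXn2r ?nnegrE// ?ler_norml; lra.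
have r2 : r ^+ 2 <= (s + C * S) ^+ 2 * A ^+ 2.
  rewrite -exprMn -[leLHS]real_normK ?num_real// lerXn2r ?nnegrE//.
  by rewrite mulr_ge0// addr_ge0 ?(ltW s0)// mulr_ge0.
have t2 : (s + C * S) ^+ 2 <= 2 * s ^+ 2 + 2 * (C ^+ 2 * S ^+ 2).
  by have := sqr_ge0 (s - C * S); nra.
have u0 : 0 <= 2 * s ^+ 2 + 2 * (C ^+ 2 * S ^+ 2).
  by rewrite addr_ge0// mulr_ge0 ?sqr_ge0// mulr_ge0 ?sqr_ge0.
apply: (le_trans r2).
apply: (@le_trans _ _ ((2 * s ^+ 2 + 2 * (C ^+ 2 * S ^+ 2)) * (p%:R * S))).
  by apply: ler_pM => //; exact: sqr_ge0.
rewrite mulrDl lerD//; first by rewrite le_eqVlt; apply/orP; left; apply/eqP; ring.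
have -> : 2 * (C ^+ 2 * S ^+ 2) * (p%:R * S) = 2 * p%:R * C ^+ 2 * (S * S ^+ 2) by ring.
have -> : C' * Q4 = 2 * p%:R * C ^+ 2 * (B * (p%:R * Q4)) by rewrite /C'; ring.
apply: ler_wpM2l; first by apply: mulr_ge0; [exact: mulr_ge0|exact: sqr_ge0].
by apply: ler_pM => //; exact: sqr_ge0.
Qed.

(** The square of [a + r] differs from [a^2] by at most
    [s a^2 + (1 + 1/s) r^2]. *)
Lemma chain_rule_cvg :
  (fun n => J n (fun z => delta Ff z ^+ 2)) @ \oo -->
  \sum_i \sum_j \int[nu]_x (dF i x * dF j x * realGam (f i) (f j) x).
Proof.
set T := \sum_i _.
have lim := linear_increment_cvg; rewrite -/T in lim.
apply: cvg_by_approximation => e e0.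
exists (fun n => J n (fun z => linear_increment z ^+ 2)), T; split => //.
  by rewrite subrr normr0 ltW.
have c0 : 0 < 2 * (`|T| + 1) by rewrite mulr_gt0// ltr_wpDl.
pose s := e / (2 * (`|T| + 1)).
have s0 : 0 < s by rewrite divr_gt0.
have k0 : 0 < 1 + s^-1 by rewrite addr_gt0// invr_gt0.
have e2k : 0 < e / 2 / (1 + s^-1) by rewrite divr_gt0//; lra.
have limT : \forall n \near \oo, J n (fun z => linear_increment z ^+ 2) <= `|T| + 1.
  move/cvgrPdist_le : lim => /(_ _ ltr01); apply: filterS => n.
  by rewrite ler_norml; have := ler_norm T; lra.
have lim0 : \forall n \near \oo,
    J n (fun z => (delta Ff z - linear_increment z) ^+ 2) <= e / 2 / (1 + s^-1).
  move/cvgrPdist_le : remainder_cvg0 => /(_ _ e2k); apply: filterS => n.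
  by rewrite ler_norml; lra.
near=> n.
have J1 : J n (fun z => linear_increment z ^+ 2) <= `|T| + 1 by near: n.
have J2 : J n (fun z => (delta Ff z - linear_increment z) ^+ 2) <= e / 2 / (1 + s^-1).
  by near: n.
have bF := bm_delta bm_Ff; have bL := bm_linear_increment.
rewrite -scaled_meanB; [|exact: bmX..].
apply: (@le_trans _ _ (J n (fun z => s * linear_increment z ^+ 2 +
    (1 + s^-1) * (delta Ff z - linear_increment z) ^+ 2))).
  apply: norm_scaled_mean_le => //.
  - by apply: bmB; exact: bmX.
  - by apply: bmD; apply: bmM (bm_cst _) _; apply: bmX => //; exact: bmB.
  move=> z; move: (delta Ff z) (linear_increment z) => q a.
  have P1 : 0 <= (s * a + (q - a)) ^+ 2 / s by rewrite divr_ge0 ?sqr_ge0// ltW.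
  have P2 : 0 <= (s * a - (q - a)) ^+ 2 / s by rewrite divr_ge0 ?sqr_ge0// ltW.
  have E1 : (s * a + (q - a)) ^+ 2 / s = s * a ^+ 2 + 2 * (a * (q - a)) + s^-1 * (q - a) ^+ 2.
    by field; rewrite gt_eqF.
  have E2 : (s * a - (q - a)) ^+ 2 / s = s * a ^+ 2 - 2 * (a * (q - a)) + s^-1 * (q - a) ^+ 2.
    by field; rewrite gt_eqF.
  have P3 := sqr_ge0 (q - a).
  rewrite (_ : q ^+ 2 - a ^+ 2 = 2 * (a * (q - a)) + (q - a) ^+ 2); last by ring.
  by rewrite ler_norml; lra.
rewrite scaled_meanD; [|by apply: bmM (bm_cst _) _; apply: bmX => //; exact: bmB..].
rewrite !scaled_meanZ; [|by apply: bmX => //; exact: bmB..].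
have -> : e = s * (`|T| + 1) + (1 + s^-1) * (e / 2 / (1 + s^-1)).
  rewrite [X in _ + X]mulrC divfK ?gt_eqF// /s.
  by field; rewrite gt_eqF// ltr_wpDl.
by apply: lerD; rewrite ler_wpM2l// ltW.
Unshelve. all: by end_near.
Qed.

(** The integral of the complex-valued Gamma is real: its imaginary part
    integrates to 0 against the uniform closure of the real part of [D]. *)
Lemma cint_carre_du_champ :
  cint nu (fun x => \sum_(i < p) \sum_(j < p)
      (partial F i (\row_k f k x))%:C * (partial F j (\row_k f k x))%:C *
      Gam (toC (f i)) (toC (f j)) x) =
  (\sum_i \sum_j \int[nu]_x (dF i x * dF j x * realGam (f i) (f j) x))%:C.
Proof.
have [_ cdF] := F_C1.
have bdd i j : bounded_measurable (fun x => dF i x * dF j x).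
  exact: (bmM (bm_dF i) (bm_dF j)).
have iRe i j : nu.-integrable setT (EFin \o (fun x => dF i x * dF j x * realGam (f i) (f j) x)).
  by apply: integrable_bmM (bdd i j) _; exact: realGam_integrable.
have iIm i j : nu.-integrable setT (EFin \o (fun x => dF i x * dF j x * imGam (f i) (f j) x)).
  by apply: integrable_bmM (bdd i j) _; exact: imGam_integrable.
have Im0 i j : \int[nu]_x (dF i x * dF j x * imGam (f i) (f j) x) = 0.
  have cdd : continuous (fun v => partial F i v * partial F j v).
    by move=> v; apply: continuousM; exact: cdF.
  by have [] := carre_du_champ_closure (f_D i) (f_D j) (closure_comp cdd).
rewrite /cint; congr Complex.
- under [RHS]eq_bigr do rewrite -Rintegral_sum//.
  rewrite -Rintegral_sum; last by move=> i; exact: integrable_real_sum.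
  apply: eq_Rintegral => x _; rewrite raddf_sum; apply: eq_bigr => i _.
  rewrite raddf_sum; apply: eq_bigr => j _; rewrite /realGam.
  by case: (Gam _ _ _) => a b /=; ring.
- transitivity (\int[nu]_x (\sum_i \sum_j (dF i x * dF j x * imGam (f i) (f j) x))).
    apply: eq_Rintegral => x _; rewrite raddf_sum; apply: eq_bigr => i _.
    rewrite raddf_sum; apply: eq_bigr => j _; rewrite /imGam.
    by case: (Gam _ _ _) => a b /=; ring.
  rewrite Rintegral_sum; last by move=> i; exact: integrable_real_sum.
  rewrite big1// => i _; rewrite Rintegral_sum// big1// => j _.
Qed.

End ChainRule.

End Energy.

Unset Implicit Arguments.

Theorem theorem2 (R : realType) (d d' : measure_display)
    (Omega : measurableType d) (E : measurableType d')
    (P : probability Omega R)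
    (Y : {RV P >-> E}) (Yn : nat -> {RV P >-> E})
    (alpha : nat -> R) (alpha_gt0 : forall n, 0 < alpha n)
    (K : set R[i]) (K_field : real_or_complex K)
    (D : set (E -> R[i])) (D_alg : bounded_algebra K D)
    (D_dense : dense_L2 K (distribution P Y) D)
    (generator : forall phi, D phi ->
       exists2 A, LfunK K (distribution P Y) 2%:E A &
       forall chi, D chi ->
         (fun n => (alpha n)%:C * increment_form (Yn n) Y phi chi) @ \oo -->
         (- 2 * cint (distribution P Y) (fun x => A x * chi x) : R[i]^o))
    (dom : set (E -> R[i])) (form : (E -> R[i]) -> (E -> R[i]) -> R[i])
    (form_def : smallest_closed_extension K (distribution P Y)
       D (limit_form alpha Yn Y) dom form)
    (Gam : (E -> R[i]) -> (E -> R[i]) -> E -> R[i])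
    (Gam_def : square_field_operator K (distribution P Y) dom form Gam)
    (form_local : local_form dom form)
    (p : nat) (p_ge1 : (1 <= p)%N)
    (f : 'I_p -> E -> R) (f_D : forall i, D (toC (f i)))
    (F : 'rV[R]_p -> R) (F_C1 : C1 F) :
  (fun n => (alpha n * \int[P]_w
      (F (\row_i f i (Yn n w)) - F (\row_i f i (Y w))) ^+ 2)%:C) @ \oo -->
  (cint (distribution P Y) (fun x => \sum_(i < p) \sum_(j < p)
      (partial F i (\row_k f k x))%:C * (partial F j (\row_k f k x))%:C *
      Gam (toC (f i)) (toC (f j)) x) : R[i]^o).
Proof.
have [form_closed form_ext _] := form_def.
rewrite (cint_carre_du_champ alpha_gt0 K_field D_alg generator form_closed form_ext
  form_local Gam_def f_D F_C1).
exact: cvg_real_complex (chain_rule_cvg alpha_gt0 K_field D_alg generator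
  form_closed form_ext form_local Gam_def f_D F_C1).
Qed.
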